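(* Let $T$ be a complete first-order theory, $M\models T$, and $A\subseteq M$ such that $M$ is atomic over $A$ and strongly $\omega$-homogeneous over $A$. (i) If $T$ is stable, then there is a unique $Aut(M/A)$-invariant Keisler measure on $Aut(M/A)$. Moreover, if $A$ is algebraically closed in $T^{eq}$, this unique invariant Keisler measure takes only the values $0$ and $1$. (ii) If $T$ is arbitrary and $M=acl(A)$, then there is a unique $Aut(M/A)$-invariant Keisler measure on $Aut(M/A)$. Moreover, the definable subsets of $Aut(M/A)$ are exactly the clopen subsets of the profinite group $Aut(M/A)$ (with the pointwise convergence topology), and the unique invariant Keisler measure coincides with (the restriction to clopen sets of) the normalized Haar measure of $Aut(M/A)$.
   Context: $M$ is atomic over $A$ if the type over $A$ of every finite tuple from $M$ is isolated; $M$ is strongly $\omega$-homogeneous over $A$ if whenever finite tuples $a,b$ from $M$ have the same type over $A$, there is $\sigma\in Aut(M/A)$ with $\sigma(a)=b$. A definable subset of $Aut(M/A)$ is a set of the form $\{\sigma\in Aut(M/A): M\models\phi(\sigma(\bar b),\bar b)\}$ where $\phi(\bar x,\bar y)$ is a formula with parameters from $A$, $\bar x,\bar y$ are finite tuples of variables of the same length, and $\bar b$ is a finite tuple from $M$. These sets form a Boolean algebra $Def(Aut(M/A))$, invariant under left translation $X\mapsto \tau X=\{\tau\sigma:\sigma\in X\}$ for $\tau\in Aut(M/A)$. A Keisler measure on $Aut(M/A)$ is a finitely additive probability measure on $Def(Aut(M/A))$; it is $Aut(M/A)$-invariant if $\mu(\tau X)=\mu(X)$ for all $\tau\in Aut(M/A)$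 and $X\in Def(Aut(M/A))$. *)

(* Defs.v *)
From HB Require Import structures.
From mathcomp Require Import all_boot all_order all_algebra.
From mathcomp Require Import all_classical all_reals all_analysis.

Set Implicit Arguments.
Unset Strict Implicit.
Unset Printing Implicit Defensive.

Import Order.TTheory GRing.Theory Num.Theory.

Local Open Scope classical_set_scope.

Section Syntax.

Record language := Language {
  fsym : Type;
  farity : fsym -> nat;
  rsym : Type;
  rarity : rsym -> nat }.

Variable L : language.

Inductive term (X : Type) : Type :=
| Var of X
| App (f : fsym L) of ('I_(farity f) -> term X).

(* [formula X] is the type of first-order formulas whose free variables are
   named by the elements of X; a quantifier binds the fresh variable [None] of
   [option X].  Since formulas are finite, only finitely many elements of X
   occur in a formula, even when X is infinite. *)
Inductive formula (X : Type) : Type :=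
| Bot
| Equal of term X & term X
| Rel (r : rsym L) of ('I_(rarity r) -> term X)
| Imp of formula X & formula X
| All of formula (option X).

Definition sentence := formula void.
Definition theory := set sentence.

Record structure := Structure {
  carrier :> Type;
  fint : forall f : fsym L, ('I_(farity f) -> carrier) -> carrier;
  rint : forall r : rsym L, ('I_(rarity r) -> carrier) -> Prop;
  carrier_inhabited : inhabited carrier }.

End Syntax.

Arguments Bot {L X}.
Arguments Var {L X}.
Arguments App {L X}.
Arguments Rel {L X}.
Arguments fint {L} s f _.
Arguments rint {L} s r _.

Section Semantics.

Fixpoint eval (L : language) (M : structure L) (X : Type) (v : X -> M)
    (t : term L X) : M :=
  match t with
  | Var x => v x
  | App f u => fint M f (fun i => eval v (u i))
  end.

Definition extend (T X : Type) (v : X -> T) (m : T) (o : option X) : T :=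
  if o is Some x then v x else m.

Fixpoint sat (L : language) (M : structure L) (X : Type) (p : formula L X) :
    (X -> M) -> Prop :=
  match p with
  | Bot => fun=> False
  | Equal s t => fun v => eval v s = eval v t
  | Rel r u => fun v => rint M r (fun i => eval v (u i))
  | Imp p1 p2 => fun v => sat p1 v -> sat p2 v
  | All p1 => fun v => forall m : M, sat p1 (extend v m)
  end.

(* Assignments for tuples of variables put side by side:
   [sat p (glue a b)] reads M |= p(a, b). *)
Definition glue (T X Y : Type) (u : X -> T) (v : Y -> T) (z : X + Y) : T :=
  match z with inl x => u x | inr y => v y end.

Variable L : language.

Definition models (N : structure L) (T : theory L) :=
  forall p, T p -> sat p (@of_void N).

Definition entails (T : theory L) (p : sentence L) :=
  forall N : structure L, models N T -> sat p (@of_void N).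

Definition complete (T : theory L) :=
  (exists N : structure L, models N T) /\
  forall p : sentence L, entails T p \/ entails T (Imp p Bot).

(* T is stable if for every formula p(x, y) there is some k such that p does not
   have the k-order property (has no ladder of length k) in models of T: Hodges,
   Model Theory, section 6.7, up to the convention i < j instead of i <= j. *)
Definition ladder (N : structure L) (n m : nat) (p : formula L ('I_n + 'I_m))
    (k : nat) :=
  exists (a : 'I_k -> 'I_n -> N) (b : 'I_k -> 'I_m -> N),
    forall i j : 'I_k, sat p (glue (a i) (b j)) <-> (i < j)%N.

Definition stable (T : theory L) :=
  forall (n m : nat) (p : formula L ('I_n + 'I_m)),
  exists k : nat, forall N : structure L, models N T -> ~ ladder N p k.

End Semantics.

Section OverParameters.
Variables (L : language) (M : structure L) (A : set M).

(* Formulas in the variables X with parameters from A: each element of A is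
   allowed as an additional variable, always interpreted by itself. *)
Definition pformula (X : Type) := formula L (X + A).

Definition psat (X : Type) (p : pformula X) (a : X -> M) : Prop :=
  sat p (glue a (fun c : A => val c)).

Definition tp (n : nat) (a : 'I_n -> M) : set (pformula 'I_n) :=
  [set p | psat p a].

Definition isolated (n : nat) (a : 'I_n -> M) :=
  exists2 p, tp a p &
    forall q, tp a q -> forall c : 'I_n -> M, psat p c -> psat q c.

Definition atomic := forall (n : nat) (a : 'I_n -> M), isolated a.

Definition acl : set M :=
  [set m | exists p : pformula unit,
     psat p (fun=> m) /\ finite_set [set c | psat p (fun=> c)]].

Definition dcl : set M :=
  [set m | exists p : pformula unit, [set c | psat p (fun=> c)] = [set m]].

End OverParameters.

Arguments tp {L M} A {n} a _.

Section Imaginaries.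
Variables (L : language) (T : theory L).

Record eqrel := Eqrel {
  edim : nat;
  efm : formula L ('I_edim + 'I_edim);
  efmP : forall N : structure L, models N T ->
    RelationClasses.Equivalence
      (fun a b : 'I_edim -> N => sat efm (glue a b)) }.

(* L^eq in its one-sorted presentation (Shelah): a predicate for the home sort
   and one for each imaginary sort, the symbols of L, and the projections
   pi_E.  The functions of L and the projections are only defined on the home
   sort, so they are given by their graphs, with the value in position 0. *)
Inductive eq_rsym :=
| Home
| Sort of eqrel
| OldRel of rsym L
| OldFun of fsym L
| Proj of eqrel.

Definition eq_rarity (s : eq_rsym) : nat :=
  match s with
  | Home | Sort _ => 1
  | OldRel r => rarity r
  | OldFun f => (farity f).+1
  | Proj E => (edim E).+1
  end.

Definition eq_language : language :=
  {| fsym := void; farity := @of_void nat;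
     rsym := eq_rsym; rarity := eq_rarity |}.

Variable M : structure L.

Definition eclass (E : eqrel) (a : 'I_(edim E) -> M) : set ('I_(edim E) -> M) :=
  [set b | sat (efm E) (glue a b)].

Record imaginary := Imaginary {
  isort : eqrel;
  iclass : set ('I_(edim isort) -> M);
  iclassP : exists a, iclass = eclass a }.

Definition proj (E : eqrel) (a : 'I_(edim E) -> M) : imaginary :=
  Imaginary (ex_intro _ a erefl).

Definition eq_carrier : Type := M + imaginary.

Definition eq_rint (s : eq_rsym) : ('I_(eq_rarity s) -> eq_carrier) -> Prop :=
  match s with
  | Home => fun u => exists m : M, u ord0 = inl m
  | Sort E => fun u => exists a, u ord0 = inr (@proj E a)
  | OldRel r => fun u => exists2 a, (forall i, u i = inl (a i)) & rint M r a
  | OldFun f => fun u => exists2 a, (forall i, u (lift ord0 i) = inl (a i)) &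
                                     u ord0 = inl (fint M f a)
  | Proj E => fun u => exists2 a, (forall i, u (lift ord0 i) = inl (a i)) &
                                   u ord0 = inr (@proj E a)
  end.

Lemma eq_carrier_inhabited : inhabited eq_carrier.
Proof. by case: (carrier_inhabited M) => m; exact: (inhabits (inl m)). Qed.

Definition eq_structure : structure eq_language :=
  @Structure eq_language eq_carrier
    (fun f => of_void (('I__ -> eq_carrier) -> eq_carrier) f)
    eq_rint eq_carrier_inhabited.

Definition real (m : M) : eq_structure := inl m.

(* A is algebraically closed in T^eq: acl^eq(A) = dcl^eq(A).  (A set of real
   elements stands for its definable closure in M^eq; it never literally
   contains the imaginary elements definable over it.) *)
Definition eq_acl_closed (A : set M) := acl (real @` A) = dcl (real @` A).

End Imaginaries.

#[short(type="preTopologicalGroupType")]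
HB.structure Definition PreTopologicalGroup :=
  {G of Group G & PointedTopological G}.

Section Automorphisms.
Variables (L : language) (M : structure L) (A : set M).

Record aut := Aut {
  aut_fun :> M -> M;
  aut_inv : M -> M;
  autK : cancel aut_fun aut_inv;
  autVK : cancel aut_inv aut_fun;
  aut_fint : forall f (u : 'I_(farity f) -> M),
    aut_fun (fint M f u) = fint M f (aut_fun \o u);
  aut_rint : forall r (u : 'I_(rarity r) -> M),
    rint M r (aut_fun \o u) <-> rint M r u;
  aut_fix : forall m, A m -> aut_fun m = m }.

Lemma aut_eq (s t : aut) : aut_fun s =1 aut_fun t -> s = t.
Proof.
case: s t => [f g fK gK ff fr fA] [f' g' fK' gK' ff' fr' fA'] /= ff'E.
have fE : f = f' by apply/funext.
have gE : g = g'.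
  by apply/funext => m; rewrite -[m in LHS]gK' -fE fK.
by subst f' g'; rewrite (Prop_irrelevance fK' fK) (Prop_irrelevance gK' gK)
  (Prop_irrelevance ff' ff) (Prop_irrelevance fr' fr)
  (Prop_irrelevance fA' fA).
Qed.

Definition aut_one : aut :=
  @Aut id id (fun=> erefl) (fun=> erefl) (fun _ _ => erefl)
    (fun _ _ => iff_refl _) (fun _ _ => erefl).

Lemma aut_mul_fint (s t : aut) f (u : 'I_(farity f) -> M) :
  (s \o t) (fint M f u) = fint M f ((s \o t) \o u).
Proof. by rewrite /= !aut_fint. Qed.

Lemma aut_mul_rint (s t : aut) r (u : 'I_(rarity r) -> M) :
  rint M r ((s \o t) \o u) <-> rint M r u.
Proof. exact: iff_trans (aut_rint s (t \o u)) (aut_rint t u). Qed.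

Lemma aut_mul_fix (s t : aut) m : A m -> (s \o t) m = m.
Proof. by move=> Am /=; rewrite !aut_fix. Qed.

Definition aut_mul (s t : aut) : aut :=
  Aut (can_comp (autK s) (autK t)) (can_comp (autVK t) (autVK s))
    (aut_mul_fint s t) (aut_mul_rint s t) (@aut_mul_fix s t).

Lemma aut_opp_fint (s : aut) f (u : 'I_(farity f) -> M) :
  aut_inv s (fint M f u) = fint M f (aut_inv s \o u).
Proof.
apply: (can_inj (autK s)); rewrite autVK aut_fint.
by congr fint; apply/funext => i /=; rewrite autVK.
Qed.

Lemma aut_opp_rint (s : aut) r (u : 'I_(rarity r) -> M) :
  rint M r (aut_inv s \o u) <-> rint M r u.
Proof.
apply: iff_trans (iff_sym (aut_rint s _)) _.
suff -> : s \o (aut_inv s \o u) = u by [].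
by apply/funext => i /=; rewrite autVK.
Qed.

Lemma aut_opp_fix (s : aut) m : A m -> aut_inv s m = m.
Proof. by move=> Am; rewrite -{1}(aut_fix s Am) autK. Qed.

Definition aut_opp (s : aut) : aut :=
  Aut (autVK s) (autK s) (aut_opp_fint s) (aut_opp_rint s) (@aut_opp_fix s).

HB.instance Definition _ := gen_eqMixin aut.
HB.instance Definition _ := gen_choiceMixin aut.
HB.instance Definition _ := isPointed.Build aut aut_one.

Lemma aut_mulA : associative aut_mul.
Proof. by move=> s t u; apply: aut_eq. Qed.
Lemma aut_mul1 : left_id aut_one aut_mul.
Proof. by move=> s; apply: aut_eq. Qed.
Lemma aut_1mul : right_id aut_one aut_mul.
Proof. by move=> s; apply: aut_eq. Qed.
Lemma aut_mulV : left_inverse aut_one aut_opp aut_mul.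
Proof. by move=> s; apply: aut_eq => m /=; rewrite autK. Qed.
Lemma aut_Vmul : right_inverse aut_one aut_opp aut_mul.
Proof. by move=> s; apply: aut_eq => m /=; rewrite autVK. Qed.

HB.instance Definition _ :=
  isGroup.Build aut aut_mulA aut_mul1 aut_1mul aut_mulV aut_Vmul.

HB.instance Definition _ := Topological.copy aut
  (initial_topology
    (aut_fun : aut ->
      {ptws {classic M} -> discrete_topology {classic M}})).

Definition strongly_homogeneous :=
  forall (n : nat) (a b : 'I_n -> M), tp A a = tp A b ->
  exists s : aut, s \o a = b.

Definition definable : set (set aut) :=
  [set X | exists (n : nat) (p : pformula A ('I_n + 'I_n)) (b : 'I_n -> M),
     X = [set s : aut | psat p (glue (s \o b) b)]].

End Automorphisms.

Section KeislerMeasures.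
Variables (R : realType) (L : language) (M : structure L) (A : set M).
Local Open Scope ring_scope.

(* A measure on Def(Aut(M/A)) is represented by a function on all subsets of
   Aut(M/A), whose values outside Def(Aut(M/A)) are irrelevant. *)
Definition keisler (mu : set (aut A) -> R) :=
  [/\ forall X, definable X -> 0 <= mu X,
      mu [set: aut A] = 1
    & forall X Y, definable X -> definable Y -> X `&` Y = set0 ->
        mu (X `|` Y) = mu X + mu Y].

Definition keisler_invariant (mu : set (aut A) -> R) :=
  forall (t : aut A) X, definable X -> mu [set (t * s)%g | s in X] = mu X.

Definition invariant_keisler (mu : set (aut A) -> R) :=
  keisler mu /\ keisler_invariant mu.

Definition unique_invariant_keisler (mu : set (aut A) -> R) :=
  invariant_keisler mu /\
  forall nu, invariant_keisler nu -> forall X, definable X -> nu X = mu X.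

End KeislerMeasures.

Section Haar.
Variable G : preTopologicalGroupType.

Definition topological_group :=
  continuous (fun x : G * G => (x.1 * x.2)%g) /\
  continuous (fun x : G => (x^-1)%g).

Definition profinite :=
  [/\ topological_group, compact [set: G], hausdorff_space G
    & totally_disconnected [set: G]].

Definition borel_type := g_sigma_algebraType (@open G).

Variable R : realType.
Local Open Scope ereal_scope.

Record normalized_haar (nu : probability borel_type R) : Prop := {
  haar_invariant : forall (g : G) (B : set borel_type), measurable B ->
    nu [set (g * x)%g | x in B] = nu B;
  haar_outer_regular : forall B : set borel_type, measurable B ->
    nu B = ereal_inf [set nu U | U in [set U : set G | open U /\ B `<=` U]];
  haar_inner_regular : forall U : set G, open U ->
    nu U = ereal_sup [set nu K | K in [set K : set G | compact K /\ K `<=` U]] }.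

End Haar.

(* Main.v *)
Require Import Defs.
From HB Require Import structures.
From mathcomp Require Import all_boot all_order all_algebra.
From mathcomp Require Import finmap.
From mathcomp Require Import all_classical all_reals all_analysis.
From mathcomp Require Import ring lra zify.

(** Write G = Aut(M/A).  A definable subset X of G is stable: there is a bound on
    the ladders of the relation [g s \in X], either because T is stable or, when
    M = acl(A), because finite tuples have finite orbits.  Everything about
    measures then holds for stable sets in an abstract group.

    For an ultrafilter q on G let d_q X = {s | g s \in X for q-almost all g}.
    Stability gives, for a suitable sequence (g_i) chosen along q, a bound k such
    that every s satisfies g_i s \in X <-> s \in d_q X for all but k indices i.
    Hence d_q X is a majority of left translates of X, and the left averages of
    the indicator function of X converge uniformly to that of d_q X.  If q extends
    a maximal right-invariant filter, then d_q X has only finitely many left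
    translates, and averaging over these gives a constant.  So the left averages
    of X converge uniformly to a constant c, which must be the value at X of every
    invariant measure.  Right averages converge as well, so c does not depend on
    the choices, and X |-> c is an invariant measure because d_q preserves the
    Boolean operations.

    If A is algebraically closed in T^eq, the finitely many left translates of
    d_q X are coded by imaginaries algebraic over A, hence fixed by G; so d_q X is
    empty or G, and c is 0 or 1.  If M = acl(A), then G is compact, clopen sets
    are definable by compactness, and the measure on clopen sets extends to a
    regular Borel measure. *)

Set Implicit Arguments.
Unset Strict Implicit.
Unset Printing Implicit Defensive.

Import Order.TTheory GRing.Theory Num.Theory.

Local Notation eval := Defs.eval.
Local Notation glue := Defs.glue.
Local Notation eqrel := Defs.eqrel.
Local Notation proj := Defs.proj.

Local Open Scope classical_set_scope.

(** * Stable subsets of a group *)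

Section Alternating.
Variables U V : Type.
Implicit Types E : U -> V -> bool.

(* The diagonal is left unconstrained, so that reversing the list
   exchanges a relation and its negation. *)
Definition ladder_like E : seq (U * V) -> bool :=
  pairwise (fun a b => E a.1 b.2 && ~~ E b.1 a.2).

Definition ladder_bounded E (k : nat) :=
  forall l, ladder_like E l -> (size l <= k)%N.

Lemma pairwise_rev (T : Type) (r : rel T) s :
  pairwise r (rev s) = pairwise (fun x y => r y x) s.
Proof.
elim: s => //= x s IHs; rewrite rev_cons pairwise_rcons IHs; congr (_ && _).
by rewrite all_rev.
Qed.

Lemma ladder_like_rev E l :
  ladder_like E (rev l) = ladder_like (fun x y => ~~ E x y) l.
Proof.
by rewrite /ladder_like pairwise_rev; apply: eq_pairwise => a b; rewrite negbK andbC.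
Qed.

(* The points x chosen so far have a fixed colour with respect to all later
   sets E _ t, and all later points disagree with that colour at t: hence each
   colour class is ladder_like, up to reversal. *)
Lemma unsplit_set (pos : set U -> Prop) E (k : nat) :
  (forall A B, A `<=` B -> pos A -> pos B) ->
  (forall A, pos A -> A !=set0) -> pos setT -> ladder_bounded E k ->
  exists2 A, pos A & forall t,
    ~ (pos (A `&` [set x | E x t]) /\ pos (A `\` [set x | E x t])).
Proof.
move=> posS posN posT Ek.
pose splits t A := pos (A `&` [set x | E x t]) /\ pos (A `\` [set x | E x t]).
have splitsS t A B : A `<=` B -> splits t A -> splits t B.
  move=> AB [p1 p2]; split; first by apply: posS p1; exact: setSI.
  by apply: posS p2; exact: setSD.
apply: contrapT => none.
have dense0 A : pos A -> exists2 t, setT t & splits t A.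
  move=> pA; apply: contrapT => nt; apply: none; exists A => // t st.
  by apply: nt; exists t.
(* Some column in [S] splits each positive subset of [A]. The recursion shrinks [S] to columns on
   which every point chosen so far has a single colour. *)
pose dense (A : set U) (S : set V) :=
  forall B, B `<=` A -> pos B -> exists2 t, S t & splits t B.
have build m : forall A S, pos A -> dense A S -> exists l : seq (bool * (U * V)),
    [/\ size l = m, forall a, List.In a l -> A a.2.1 /\ S a.2.2
      & pairwise (fun a b => (E a.2.1 b.2.2 == a.1) && (E b.2.1 a.2.2 == ~~ a.1)) l].
  elim: m => [|m IHm] A S pA dA; first by exists [::].
  have [x Ax] := posN _ pA.
  (* If the columns where [x] has colour [true] fail to be dense below [A], some positive [A'] is
     split by none of them, so below [A'] the columns of colour [false] are dense. *)
  have [e [A' [A'A pA' dA']]] : exists e A', [/\ A' `<=` A, pos A'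
      & dense A' [set t | S t /\ E x t = e]].
    have [d1|/existsNP[A' /not_implyP[A'A /not_implyP[pA' nA']]]] :=
        pselect (dense A [set t | S t /\ E x t = true]).
      by exists true, A; split=> //; exact: subset_refl.
    exists false, A'; split=> // B BA' pB.
    have [t St sB] := dA B (subset_trans BA' A'A) pB; exists t => //; split=> //.
    apply/negbTE/negP => Ext; apply: nA'; exists t => //.
    exact: splitsS _ _ _ BA' sB.
  have [t [St Ext] [s1 s0]] := dA' A' (@subset_refl _ A') pA'.
  pose A2 := if e then A' `\` [set x | E x t] else A' `&` [set x | E x t].
  have pA2 : pos A2 by rewrite /A2; case: (e).
  have A2A' : A2 `<=` A' by rewrite /A2; case: (e) => y [].
  have EA2 y : A2 y -> E y t = ~~ e.
    by rewrite /A2; case: (e) => -[_] //=; move/negP/negbTE.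
  have dA2 : dense A2 [set t | S t /\ E x t = e].
    by move=> B BA2; apply: dA'; exact: subset_trans BA2 A2A'.
  have [l [szl inl prl]] := IHm _ _ pA2 dA2.
  exists ((e, (x, t)) :: l); split.
  - by rewrite /= szl.
  - move=> a [<-//|/inl[A2a [Sa _]]]; split=> //; exact/A'A/A2A'.
  - rewrite /= prl andbT; elim: (l) inl => //= b l' IHl inl.
    rewrite IHl ?andbT; last by move=> a al; apply: inl; right.
    have [|/EA2 -> [_ ->]] := inl b; first by left.
    by rewrite !eqxx.
(* Among 2k + 1 pairs, one colour occurs more than k times. *)
have [l [szl _ prl]] := build (k.*2.+1) _ _ posT (fun B _ => @dense0 B).
pose l1 := [seq a.2 | a <- l & a.1]; pose l0 := [seq a.2 | a <- l & ~~ a.1].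
have sz : (size l1 + size l0 = k.*2.+1)%N.
  by rewrite !size_map !size_filter -szl -(count_predC (fun a => a.1) l).
have a1 : ladder_like E l1.
  rewrite /ladder_like pairwise_map; elim: (l) prl => //= a l' IHl.
  move=> /andP[al pl]; case: ifP => // ca /=; rewrite IHl // andbT.
  rewrite all_filter; apply: sub_all al => b /= /andP[/eqP-> /eqP->].
  by rewrite ca implybT.
have a0 : ladder_like E (rev l0).
  rewrite ladder_like_rev /ladder_like pairwise_map; elim: (l) prl => //= a l' IHl.
  move=> /andP[al pl]; case: ifP => // ca /=; rewrite IHl // andbT.
  rewrite all_filter; apply: sub_all al => b /= /andP[/eqP-> /eqP->].
  by rewrite negbK ca implybT.
have := Ek _ a1; have := Ek _ a0; rewrite size_rev; lia.
Qed.

End Alternating.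

Section InvariantFilter.
Variable G : groupType.
Implicit Types (A B X : set G) (F : set (set G)).

Definition rtranslate A (s : G) : set G := [set x | A (x * s)%g].

Definition rinvariant F := forall A s, F A -> F (rtranslate A s).

(** By Zorn's lemma. The last property is syndeticity modulo [F]: if no finite union of right
    translates of [A] belonged to [F], then [F] could be enlarged by all right translates of the
    complement of [A]. *)
Lemma maximal_rinvariant_filter : exists F,
  [/\ ProperFilter F, rinvariant F
    & forall A, ~ F (~` A) -> exists l : seq G,
        F [set x | exists2 t, t \in l & A (x * t)%g]].
Proof.
pose P F := [/\ rinvariant F, ~ F set0, (forall A B, F A -> F B -> F (A `&` B))
  & forall A B, A `<=` B -> F A -> F B].
have [|F [[Finv F0 FI FS] Fmax]] := @Zorn_bigcup _ P.
  move=> C CP Ctot; split.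
  - by move=> A s [F CF FA]; exists F => //; have [+ _ _ _] := CP _ CF; exact.
  - by move=> [F CF]; have [] := CP _ CF.
  - move=> A B [F CF FA] [F' CF' F'B].
    have [FF'|F'F] := Ctot _ _ CF CF'.
      by exists F' => //; have [_ _ + _] := CP _ CF'; apply=> //; exact: FF'.
    by exists F => //; have [_ _ + _] := CP _ CF; apply=> //; exact: F'F.
  - move=> A B AB [F CF FA]; exists F => //.
    by have [_ _ _] := CP _ CF; apply; eassumption.
have maxE F' : P F' -> F `<=` F' -> F' `<=` F.
  by move=> PF' FF'; apply: contrapT => nF'F; exact: (Fmax F').
(* [P] does not ask for [setT], so that the union of the empty chain satisfies it; maximality
   supplies [setT]. *)
have FT : F setT.
  apply: (maxE [set A | F A \/ A = setT]) => /=; last by right.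
    split.
    - by move=> A s [FA|->]; [left; exact: Finv|right; apply/seteqP].
    - by case=> [/F0 //|/esym E0]; have : [set: G] 1%g by []; rewrite E0.
    - move=> A B [FA|->] [FB|->]; rewrite ?setIT ?setTI; try by [left|right].
      by left; exact: FI.
    - move=> A B AB [/(FS _ _ AB)|AT]; [by left|right].
      by apply/seteqP; split=> // x _; apply: AB; rewrite AT.
  by move=> A; left.
have FF : Filter F by apply: Build_Filter => // A B; exact: FS.
exists F; split=> //.
move=> A; apply: contra_notP => /forallNP nsyn.
pose F' := [set B | exists2 C, F C & exists l : seq G,
  C `&` [set x | forall t, t \in l -> ~ A (x * t)%g] `<=` B].
apply: (maxE F') => /=; last by exists setT => //; exists [:: 1%g] => x [_ /(_ 1%g)];
  rewrite mem_head mulg1; exact.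
  split.
  - move=> B s [C FC [l CB]]; exists (rtranslate C s); first exact: Finv.
    exists [seq (s * t)%g | t <- l] => x [Cx nx]; apply: CB; split=> // t tl.
    by rewrite -mulgA; apply: nx; apply: map_f.
  - move=> [C FC [l Cl]]; apply: (nsyn l); apply: FS FC => x Cx.
    apply: contrapT => nx; apply: (Cl x); split=> // t tl At; apply: nx.
    by exists t.
  - move=> B B' [C FC [l CB]] [C' FC' [l' CB']].
    exists (C `&` C'); first exact: FI.
    exists (l ++ l') => x [[Cx C'x] nx]; split.
      by apply: CB; split=> // t tl; apply: nx; rewrite mem_cat tl.
    by apply: CB'; split=> // t tl; apply: nx; rewrite mem_cat tl orbT.
  - move=> B B' BB' [C FC [l CB]]; exists C => //; exists l.
    exact: subset_trans CB BB'.
by move=> B FB; exists B => //; exists [::] => x [].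
Qed.

End InvariantFilter.

Lemma left_translateE (G : groupType) (t : G) (X : set G) :
  [set (t * s)%g | s in X] = [set s | X (t^-1 * s)%g].
Proof.
apply/seteqP; split=> [_ [s Xs <-] /=|s /= Xs]; first by rewrite mulKg.
by exists (t^-1 * s)%g => //; rewrite mulVKg.
Qed.

Section StableSets.
Variable G : groupType.
Implicit Types (A B X : set G) (F q : set (set G)).

Definition stable_set X :=
  exists k, ladder_bounded (fun g s : G => (g * s)%g \in X) k.

(** Inverting a product exchanges its factors. Hence inverting and exchanging the components of a
    ladder, and reversing the list, gives a ladder of the same length. *)
Lemma stable_set_inv X : stable_set X -> stable_set [set g | X (g^-1)%g].
Proof.
move=> [k Xk]; exists k => l al.
pose l' := rev [seq ((a.2^-1)%g, (a.1^-1)%g) | a <- l].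
have invE x : (x \in [set g | X (g^-1)%g]) = ((x^-1)%g \in X).
  by apply/idP/idP; rewrite !inE.
have /Xk : ladder_like (fun g s : G => (g * s)%g \in X) l'.
  rewrite /ladder_like pairwise_rev pairwise_map; move: al.
  by apply: sub_pairwise => a b /=; rewrite !invE !invgM.
by rewrite size_rev size_map.
Qed.

(** This is the set d_q X of the overview. *)
Definition translate_limit q X : set G := [set s | q (rtranslate X s)].

Lemma ultra_seq_bigcup q (I : eqType) (l : seq I) (A : I -> set G) :
  UltraFilter q -> q [set x | exists2 i, i \in l & A i x] ->
  exists2 i, i \in l & q (A i).
Proof.
move=> qU; elim: l => [|i l IHl] qA.
  by exfalso; have [x [j]] := filter_ex qA; rewrite in_nil.
have [qi|qni] := in_ultra_setVsetC (A i) qU; first by exists i; rewrite ?mem_head.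
case: IHl => [|j jl qj]; last by exists j; rewrite ?in_cons ?jl ?orbT.
apply: filterS (filterI qA qni) => x [[j]]; rewrite in_cons => /orP[/eqP->//|jl].
by move=> Ajx _; exists j.
Qed.

(** Call a set positive if its complement is not in [F]. Stability gives a positive [A] that no set
    of the form [[set x | X (x * t)]] splits into two positive parts, and finitely many right
    translates of [A] cover a member of [F]. For each [u], one of them, shifted by [u], lies in [q];
    its index [t] in [l] then determines the whole row of [u]. *)
Lemma translate_limit_finite_orbit F q X :
    ProperFilter F -> rinvariant F ->
    (forall A, ~ F (~` A) -> exists l : seq G,
        F [set x | exists2 t, t \in l & A (x * t)%g]) ->
    UltraFilter q -> F `<=` q -> stable_set X ->
  exists (l : seq G) (tau : G -> G -> bool), forall u, exists2 t, t \in l &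
    forall s, ((u * s)%g \in translate_limit q X) = tau t s.
Proof.
move=> FF Finv Fsyn qU Fq [k Xk].
have [|||A pA unsplit] := @unsplit_set G G (fun A => ~ F (~` A)) _ k _ _ _ Xk.
- move=> A B AB nA FB; apply: nA; apply: filterS FB; exact: subsetC.
- move=> A nA; apply/set0P/eqP => A0; apply: nA; rewrite A0 setC0; exact: filterT.
- by rewrite setCT; exact: filter_not_empty.
have [l Fl] := Fsyn _ pA.
exists l; exists (fun t s => `[< F [set x | A (x * t)%g -> X (x * s)%g] >]) => u.
have [t tl qt] := @ultra_seq_bigcup q G l (fun t => [set x | A (x * u * t)%g])
  qU (Fq _ (Finv _ u Fl)).
exists t => // s; apply/idP/asboolP => [|Fs]; last first.
  rewrite inE /translate_limit /rtranslate /=.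
  apply: filterS (filterI qt (Fq _ (Finv _ u Fs))) => x [/= Ax AX].
  by rewrite mulgA; exact: AX.
rewrite inE /translate_limit /rtranslate /= => qus; apply: contrapT => nF.
(* The column of [t^-1 * s] does not split [A]: since [F] does not force [A] into it, [F] forces [A]
   out of it. *)
have Fn : F [set x | A x -> ~ X (x * (t^-1 * s))%g].
  apply: contrapT => nF'; apply: (unsplit (t^-1 * s)%g); split=> /= [FA|FA].
    by apply: nF'; apply: filterS FA => x nAX Ax Xx; apply: nAX; split=> //=; rewrite inE.
  apply: nF; apply: filterS (Finv _ t FA) => x nAX Ax; apply: contrapT => nX.
  by apply: nAX; split=> //=; rewrite inE mulgA mulgK.
have [x [[/= Ax Xx] AnX]] :=
  filter_ex (filterI (filterI qt qus) (Fq _ (Finv _ (u * t)%g Fn))).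
by move: AnX; rewrite /rtranslate /= !mulgA mulgK; apply => //; rewrite -mulgA.
Qed.

(* Right multiplication by s permutes the finitely many rows of r. *)
Lemma finite_orbit_average (B : Type) (I : eqType) (r : G -> B) (l : seq I)
    (tau : I -> G -> B) :
    (forall u, exists2 t, t \in l & forall s, r (u * s)%g = tau t s) ->
  exists2 us : seq G, (0 < size us)%N & forall (P : pred B) s,
    count (fun u => P (r (u * s)%g)) us = count (fun u => P (r u)) us.
Proof.
move=> rl; pose row (u s : G) := r (u * s)%g.
pose rs : seq {classic (G -> B)} :=
  [seq f <- undup [seq (tau t : {classic (G -> B)}) | t <- l] |
    `[< exists u, f = row u >]].
have rsP (f : {classic (G -> B)}) : f \in rs <-> exists u, f = row u.
  rewrite mem_filter; split=> [/andP[/asboolP]//|[u ->]].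
  apply/andP; split; first by apply/asboolP; exists u.
  have [t tl tE] := rl u; rewrite mem_undup; apply/mapP; exists t => //.
  exact/funext.
have urs : uniq rs by rewrite filter_uniq ?undup_uniq.
pose sh s (f : {classic (G -> B)}) : {classic (G -> B)} := fun x => f (s * x)%g.
have shP s : perm_eq (map (sh s) rs) rs.
  have ush : uniq (map (sh s) rs).
    rewrite map_inj_uniq // => f g fg; apply/funext => x.
    by have := congr1 (@^~ (s^-1 * x)%g) fg; rewrite /sh mulVKg.
  have sub : {subset map (sh s) rs <= rs}.
    move=> _ /mapP[f /rsP[u ->] ->]; apply/rsP; exists (u * s)%g.
    by apply/funext => x; rewrite /sh /row mulgA.
  have [|_ eqi] := uniq_min_size ush sub; first by rewrite size_map.
  exact: uniq_perm.
pose pick (f : {classic (G -> B)}) := xget 1%g [set u | f = row u].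
have pickE f : f \in rs -> forall s, r (pick f * s)%g = f s.
  move=> /rsP[u fu] s; rewrite /pick; case: xgetP => [v _ /= ->//|/(_ u)].
  by move=> nu; exfalso; exact: nu.
exists (map pick rs).
  rewrite size_map; have : (row 1%g : {classic (G -> B)}) \in rs by apply/rsP; exists 1%g.
  by rewrite lt0n size_eq0; case: eqP => // ->.
have cE (P : pred B) s : count (fun u => P (r (u * s)%g)) (map pick rs) =
    count (fun f : {classic (G -> B)} => P (f s)) rs.
  rewrite count_map; apply: eq_in_count => f frs /=; by rewrite pickE.
move=> P s; rewrite cE.
have -> : count (fun u => P (r u)) (map pick rs) =
    count (fun u => P (r (u * 1)%g)) (map pick rs).
  by apply: eq_count => u; rewrite mulg1.
rewrite cE -[RHS](permP (shP s)) count_map; apply: eq_count => f /=.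
by rewrite /sh mulg1.
Qed.

(** The elements of [gs] are chosen one after another, each agreeing with [D] on finitely many
    witnesses fixed beforehand. The exceptions of a given [s], paired with witnesses, form a ladder
    for [X], after reversal if [s] is outside [D]; so there are at most k of them. *)
Lemma limit_approximation q X k n :
    UltraFilter q -> ladder_bounded (fun g s : G => (g * s)%g \in X) k ->
  exists2 gs : seq G, size gs = n & forall s,
    (count (fun g => ((g * s)%g \in X) != (s \in translate_limit q X)) gs <= k)%N.
Proof.
move=> qU Xk; set D := translate_limit q X.
pose exc s g := ((g * s)%g \in X) != (s \in D).
(* The last component of each pair is a witness with the same membership
   pattern as s at the time when the corresponding g was the newest one. *)
suff [gs szgs gsP] : exists2 gs : seq G, size gs = n & forall s,
    exists l : seq (G * G), [/\ map fst l = seq.filter (exc s) gs,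
      all (fun a => (a.2 \in D) == (s \in D)) l
    & pairwise (fun a b => ((a.1 * b.2)%g \in X == (s \in D)) &&
                           ((b.1 * a.2)%g \in X != (s \in D))) l].
  exists gs => // s; have [l [l1 _ pl]] := gsP s.
  rewrite -size_filter -l1 size_map; case: (s \in D) pl => pl.
    by apply: Xk; apply: sub_pairwise pl => a b /=; case: (_ \in X); case: (_ \in X).
  rewrite -size_rev; apply: Xk; rewrite ladder_like_rev.
  by apply: sub_pairwise pl => a b /=; case: (_ \in X); case: (_ \in X).
elim: n => [|n [gs szgs /choice[L LP]]].
  by exists [::] => // s; exists [::].
(* Only finitely many patterns occur, so witnesses are needed for one representative of each pattern
   only. *)
pose pat s : bool * {ffun 'I_n -> bool} :=
  (s \in D, [ffun i : 'I_n => (nth 1 gs i * s)%g \in X]).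
have patE r s : pat r = pat s ->
    (r \in D) = (s \in D) /\ seq.filter (exc r) gs = seq.filter (exc s) gs.
  move=> [rs /ffunP E]; split=> //; apply: eq_in_filter => g ggs.
  have gn : (index g gs < n)%N by rewrite -szgs index_mem.
  by have := E (Ordinal gn); rewrite !ffunE /= nth_index // /exc rs => ->.
pose rep p := xget 1%g [set s | pat s = p].
have repE s : pat (rep (pat s)) = pat s.
  by rewrite /rep; case: xgetP => [//|/(_ s)/= ns]; exfalso; exact: ns.
(* [W] is a finite set that serves every [s] at once; q-almost every [g] agrees with [D] on it. *)
pose W := flatten [seq [seq a.2 | a <- L (rep p)] | p : bool * {ffun 'I_n -> bool}].
have [g gW] : exists g, forall w, w \in W -> ((g * w)%g \in X) = (w \in D).
  apply: (@filter_ex _ q); elim: (W) => [|w W' IHW].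
    by apply: filterS filterT => g _ w.
  suff qw : q [set g | ((g * w)%g \in X) = (w \in D)].
    apply: filterS (filterI qw IHW) => g [/= gw gW'] v.
    by rewrite in_cons => /orP[/eqP->|/gW'].
  have [wD|wD] := boolP (w \in D).
    by move: (wD); rewrite inE; apply: filterS => g Xg /=; exact: mem_set.
  have [qX|] := in_ultra_setVsetC (rtranslate X w) qU.
    by move: wD; rewrite notin_setE.
  by apply: filterS => g nX /=; apply/negbTE; rewrite notin_setE.
exists (g :: gs) => [|s]; first by rewrite /= szgs.
have [rsD rsf] := patE _ _ (repE s); have [l1 lD pl] := LP (rep (pat s)).
rewrite rsD in lD pl.
have [gs_exc|gs_nexc] := boolP (exc s g); last first.
  by exists (L (rep (pat s))); split=> //=; rewrite (negbTE gs_nexc) l1.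
(* When [g] is a new exception of [s], the witness is [s] itself: the older exceptions disagree with
   [D] at [s] by definition, and [g] agrees with [D] at their witnesses, which lie in [W]. *)
exists ((g, s) :: L (rep (pat s))); split=> /=.
- by rewrite gs_exc l1 rsf.
- by rewrite eqxx.
rewrite pl andbT.
apply/allP => a aL /=; apply/andP; split.
  have -> : ((g * a.2)%g \in X) = (a.2 \in D).
    apply: gW; apply/flattenP; exists [seq b.2 | b <- L (rep (pat s))].
      by apply/mapP; exists (pat s) => //; rewrite mem_enum.
    exact: map_f.
  exact: (allP lD).
have : a.1 \in seq.filter (exc s) gs by rewrite -rsf -l1 map_f.
by rewrite mem_filter => /andP[].
Qed.

End StableSets.

(** * Means of stable sets *)

Section LeftMean.
Variables (G : groupType) (R : realType).
Implicit Types (A B X Y : set G) (q : set (set G)) (c e : R).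
Local Open Scope ring_scope.

(** Uniform approximation of the constant [c] by averages of left translates of the indicator of
    [X], multiplied by the length of the list to avoid division. *)
Definition left_mean X c := forall e, 0 < e -> exists2 l : seq G, (0 < size l)%N &
  forall s, `|(count (fun g => (g * s)%g \in X) l)%:R - c * (size l)%:R|
            <= e * (size l)%:R.

(** Of 2k + 1 translates at most k disagree with the limit at any given point, so the majority
    decides. This makes the limit of a definable set definable. *)
Lemma limit_majority q X k :
    UltraFilter q -> ladder_bounded (fun g s : G => (g * s)%g \in X) k ->
  exists gs : seq G, translate_limit q X =
    [set s | (k < count (fun g => (g * s)%g \in X) gs)%N].
Proof.
move=> qU Xk; have [gs szgs gsP] := limit_approximation k.*2.+1 qU Xk.
exists gs; apply/funext => s; have ck := gsP s.
have := count_predC (fun g => (g * s)%g \in X) gs; rewrite szgs => szE.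
rewrite propeqE; split=> /= [/mem_set sD|].
  move: ck; have -> : count (fun g => ((g * s)%g \in X) != (s \in translate_limit q X)) gs
      = count (predC (fun g => (g * s)%g \in X)) gs.
    by apply: eq_count => g /=; rewrite sD; case: (_ \in X).
  by move: szE => /=; lia.
move=> kc; apply: contrapT => nD; move: ck.
have -> : count (fun g => ((g * s)%g \in X) != (s \in translate_limit q X)) gs
    = count (fun g => (g * s)%g \in X) gs.
  by apply: eq_count => g; rewrite (memNset nD); case: (_ \in X).
by rewrite leqNgt kc.
Qed.

(** Averaging [X] over the products [g * u] first replaces [X] by its limit, up to an error of k out
    of n for each [u], and then averages the limit over [us] to a constant. *)
Lemma left_mean_of_limit q X (us : seq G) (N : nat) :
    UltraFilter q -> stable_set X -> (0 < size us)%N ->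
    (forall s, count (fun u => (u * s)%g \in translate_limit q X) us = N) ->
  left_mean X (N%:R / (size us)%:R).
Proof.
move=> qU [k Xk] us0 usN e e0.
(* Large enough for k / n to be at most [e]. *)
pose n := (Num.bound (k%:R / e)).+1.
have kn : k%:R <= e * n%:R :> R.
  rewrite mulrC -ler_pdivrMr //; apply: ltW; apply: lt_le_trans (archi_boundP _) _.
    by rewrite divr_ge0 // ltW.
  by rewrite ler_nat.
have [gs szgs gsP] := limit_approximation n qU Xk.
exists [seq (g * u)%g | u <- us, g <- gs].
  by rewrite size_allpairs muln_gt0 us0 szgs.
move=> s; rewrite size_allpairs szgs natrM.
have us_neq0 : (size us)%:R != 0 :> R by rewrite pnatr_eq0 -lt0n.
have -> : N%:R / (size us)%:R * ((size us)%:R * n%:R) = n%:R * N%:R :> R by field.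
have bound vs : `|(count (fun g => (g * s)%g \in X)
      [seq (g * u)%g | u <- vs, g <- gs])%:R
    - n%:R * (count (fun u => (u * s)%g \in translate_limit q X) vs)%:R|
    <= k%:R * (size vs)%:R :> R.
  elim: vs => [|u vs IHvs] /=; first by rewrite !mulr0 subrr normr0.
  rewrite count_cat count_map.
  set a := count _ gs; set b := count _ (flatten _); set d := count _ vs.
  have {IHvs}IHvs : `|b%:R - n%:R * d%:R| <= k%:R * (size vs)%:R :> R by [].
  have ka : `|a%:R - n%:R * ((u * s)%g \in translate_limit q X)%:R| <= k%:R :> R.
    have aE : a = count (fun g => (g * (u * s))%g \in X) gs.
      by apply: eq_count => g /=; rewrite mulgA.
    have := gsP (u * s)%g; have := count_predC (fun g => (g * (u * s))%g \in X) gs.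
    rewrite szgs -aE; case: (_ \in translate_limit q X).
      set p := count _ gs; set p' := count _ gs.
      have -> : p' = p by apply: eq_count => g /=; case: (_ \in X).
      by move=> <- pk; rewrite mulr1 natrD opprD addNKr normrN normr_nat ler_nat.
    set p := count _ gs; set p' := count _ gs => _.
    have -> : p' = a by rewrite aE; apply: eq_count => g; case: (_ \in X).
    by rewrite mulr0 subr0 normr_nat ler_nat.
  have -> : (a + b)%:R - n%:R * (((u * s)%g \in translate_limit q X) + d)%:R =
      (a%:R - n%:R * ((u * s)%g \in translate_limit q X)%:R) + (b%:R - n%:R * d%:R) :> R.
    by rewrite !natrD; ring.
  apply: le_trans (ler_normD _ _) _; rewrite -natr1 mulrDr mulr1 addrC.
  exact: lerD.
have := bound us; rewrite usN => /le_trans; apply.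
by rewrite mulrA [e * _]mulrC -mulrA mulrC ler_wpM2l.
Qed.

Lemma count_average (F : G -> nat) (l : seq G) (a b : R) :
    (forall s, `|(F s)%:R - a| <= b) ->
  `|(\sum_(s <- l) F s)%:R - a * (size l)%:R| <= b * (size l)%:R.
Proof.
move=> Fab; elim: l => [|s l IHl]; first by rewrite big_nil !mulr0 subrr normr0.
rewrite big_cons /= -natr1 natrD.
have -> : (F s)%:R + (\sum_(j <- l) F j)%:R - a * ((size l)%:R + 1) =
  ((F s)%:R - a) + ((\sum_(j <- l) F j)%:R - a * (size l)%:R) by ring.
apply: le_trans (ler_normD _ _) _; rewrite mulrDr mulr1 addrC.
exact: lerD.
Qed.

Lemma sum_count (P : G -> G -> bool) (l l' : seq G) :
  (\sum_(s <- l') count (fun g => P g s) l = \sum_(g <- l) count (P g) l')%N.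
Proof.
under eq_bigr do rewrite -sum1_count big_mkcond.
by rewrite exchange_big; apply: eq_bigr => g _; rewrite -sum1_count [RHS]big_mkcond.
Qed.

(* Averaging X over g s^-1 in both orders compares left and right averages. *)
Lemma left_mean_inv X c c' :
  left_mean X c -> left_mean [set g | X (g^-1)%g] c' -> c = c'.
Proof.
move=> Xc Xc'; apply/eqP; rewrite -subr_eq0 -normr_le0; apply/ler_addgt0Pr => e e0.
have e2 : 0 < e / 2 by rewrite divr_gt0.
have [l l0 lP] := Xc _ e2; have [l' l'0 l'P] := Xc' _ e2.
have := @count_average (fun s => count (fun g => (g * s^-1)%g \in X) l) l' _ _
  (fun s => lP (s^-1)%g).
have := @count_average
  (fun g => count (fun s => (s * g^-1)%g \in [set g | X (g^-1)%g]) l') l _ _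
  (fun s => l'P (s^-1)%g).
rewrite (sum_count (fun g s => (g * s^-1)%g \in X)).
have -> : (\sum_(g <- l) count (fun s => (s * g^-1)%g \in [set g | X (g^-1)%g]) l' =
    \sum_(g <- l) count (fun s => (g * s^-1)%g \in X) l')%N.
  apply: eq_bigr => g _; apply: eq_count => s.
  by apply/idP/idP; rewrite !inE /= invgM invgK.
set S := (\sum_(g <- l) _)%:R => S1 S2.
have ll0 : 0 < (size l)%:R * (size l')%:R :> R by rewrite mulr_gt0 ?ltr0n.
rewrite add0r -(ler_pM2r ll0) -[X in `|_| * X]gtr0_norm // -normrM.
have -> : (c - c') * ((size l)%:R * (size l')%:R) =
  (S - c' * (size l')%:R * (size l)%:R) - (S - c * (size l)%:R * (size l')%:R) by ring.
apply: le_trans (ler_normB _ _) _; apply: le_trans (lerD S1 S2) _.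
by rewrite le_eqVlt; apply/orP; left; apply/eqP; field.
Qed.

Lemma left_mean_translate X c (t : G) :
  left_mean X c -> left_mean [set (t * s)%g | s in X] c.
Proof.
move=> Xc e /Xc[l l0 lP]; exists [seq (t * g)%g | g <- l]; first by rewrite size_map.
move=> s; rewrite size_map count_map.
rewrite (eq_count (a2 := fun g => (g * s)%g \in X)) // => g /=.
apply/idP/idP; rewrite !inE /=; last by exists (g * s)%g; rewrite ?mulgA.
by move=> [x Xx]; rewrite -mulgA => /mulgI <-.
Qed.

Lemma left_mean_ge0 X c : left_mean X c -> 0 <= c.
Proof.
move=> Xc; rewrite -oppr_le0; apply/ler_addgt0Pr => e e0.
have [l l0 /(_ 1%g)] := Xc e e0; rewrite ler_norml => /andP[_ cl].
rewrite -(ltr0n R) in l0; rewrite -(ler_pM2r l0) add0r.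
by apply: (le_trans _ cl); rewrite mulNr lerDr ler0n.
Qed.

Lemma left_mean_const X c (b : bool) :
  (forall s, (s \in X) = b) -> c = b%:R -> left_mean X c.
Proof.
move=> Xb -> e e0; exists [:: 1%g] => // s /=.
by rewrite Xb addn0 mulr1 subrr normr0 mulr1 ltW.
Qed.

(* Any ultrafilter q extending a maximal right-invariant filter works
   simultaneously for all stable sets. *)
Lemma generic_ultrafilter : exists2 q : set (set G), UltraFilter q &
  forall X, stable_set X -> exists (l : seq G) (tau : G -> G -> bool),
    forall u, exists2 t, t \in l &
      forall s, ((u * s)%g \in translate_limit q X) = tau t s.
Proof.
have [F [FF Finv Fsyn]] := maximal_rinvariant_filter G.
have [q [qU Fq]] := ultraFilterLemma FF; exists q => // X Xst.
exact: translate_limit_finite_orbit Finv Fsyn qU Fq Xst.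
Qed.

(** One ultrafilter and one list [us], obtained by averaging the pair of membership values, serve
    both sets. The limits are disjoint with union the limit of the union, so the counts over [us]
    add up. *)
Lemma left_mean_exists2 X Y : stable_set X -> stable_set Y -> X `&` Y = set0 ->
  exists c c' : R, [/\ left_mean X c, left_mean Y c' &
    stable_set (X `|` Y) -> left_mean (X `|` Y) (c + c')].
Proof.
move=> Xst Yst XY0; have [q qU qP] := generic_ultrafilter.
have [l [tau lP]] := qP _ Xst; have [l' [tau' l'P]] := qP _ Yst.
pose r u := (u \in translate_limit q X, u \in translate_limit q Y).
pose ll := [seq (t, t') | t <- l, t' <- l'].
have [|us us0 usP] := @finite_orbit_average G _ _ r ll
    (fun p s => (tau p.1 s, tau' p.2 s)).
  move=> u; have [t tl tE] := lP u; have [t' t'l t'E] := l'P u.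
  by exists (t, t') => [|s]; [exact: allpairs_f|rewrite /r tE t'E].
pose N := count (fun u => u \in translate_limit q X) us.
pose N' := count (fun u => u \in translate_limit q Y) us.
have usX s : count (fun u => (u * s)%g \in translate_limit q X) us = N.
  exact: (usP (fun p => p.1)).
have usY s : count (fun u => (u * s)%g \in translate_limit q Y) us = N'.
  exact: (usP (fun p => p.2)).
exists (N%:R / (size us)%:R), (N'%:R / (size us)%:R); split.
- exact: left_mean_of_limit usX.
- exact: left_mean_of_limit usY.
move=> XYst; rewrite -mulrDl -natrD; apply: (left_mean_of_limit qU) => // s.
rewrite -(usX s) -(usY s) -count_predUI [X in (_ + X)%N](_ : _ = 0%N) ?addn0.
  apply: eq_count => u; apply/idP/orP => [/set_mem qXY|].
    have [qX|qnX] := in_ultra_setVsetC (rtranslate X (u * s)%g) qU.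
      by left; exact: mem_set.
    right; apply: mem_set; apply: filterS (filterI qXY qnX) => g [[]] //.
  by case=> /set_mem qX; apply: mem_set; apply: filterS qX => g ?; [left|right].
apply/eqP; rewrite -leqn0 leqNgt -has_count; apply/hasPn => u _ /=.
apply/negP => /andP[]; rewrite !inE => qX qY.
have [g [Xg Yg]] := filter_ex (filterI qX qY).
by have : (X `&` Y) (g * (u * s))%g by []; rewrite XY0.
Qed.

Lemma left_mean_exists X : stable_set X -> exists c : R, left_mean X c.
Proof.
move=> Xst; have Est : stable_set (set0 : set G).
  by exists 1%N => -[|a [|b l]] //=; rewrite /ladder_like /= memNset.
have [c [_ [Xc _ _]]] := left_mean_exists2 Xst Est (setI0 X).
by exists c.
Qed.

(** Every left mean of [X] equals every left mean of its set of inverses, and the latter set is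
    stable, so it has one. *)
Lemma left_mean_unique X c c' :
  stable_set X -> left_mean X c -> left_mean X c' -> c = c'.
Proof.
move=> /stable_set_inv/left_mean_exists[d Xd] Xc Xc'.
by rewrite (left_mean_inv Xc Xd) (left_mean_inv Xc' Xd).
Qed.

End LeftMean.

(** * Invariant finitely additive measures take the left mean as their value *)

Section InvariantMeasures.
Variables (G : groupType) (R : realType) (B : set (set G)).
Variable nu : set G -> R.
Implicit Types X Y : set G.
Local Open Scope ring_scope.
Hypotheses (BT : B setT) (BI : forall X Y, B X -> B Y -> B (X `&` Y)).
Hypothesis BC : forall X, B X -> B (~` X).
Hypothesis BM : forall (t : G) X, B X -> B [set (t * s)%g | s in X].
Hypotheses (nu0 : forall X, B X -> 0 <= nu X) (nu1 : nu setT = 1).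
Hypothesis nuU : forall X Y, B X -> B Y -> X `&` Y = set0 ->
  nu (X `|` Y) = nu X + nu Y.
Hypothesis nuM : forall (t : G) X, B X -> nu [set (t * s)%g | s in X] = nu X.

Lemma finitely_additive_split X Y : B X -> B Y ->
  nu X = nu (X `&` Y) + nu (X `\` Y).
Proof.
move=> BX BY; rewrite -nuU; [by rewrite setUIDK|exact: BI|by apply: BI => //; exact: BC|].
by rewrite setDE setICA -setIA setICr !setI0.
Qed.

Lemma finitely_additive_set0 : nu set0 = 0.
Proof.
have B0 : B set0 by rewrite -setCT; exact: BC.
by have := nuU B0 B0 (setI0 _); rewrite setU0 => /eqP; rewrite addrC -subr_eq subrr => /eqP.
Qed.

(** This integrates an inequality between simple functions. Splitting [X] along the first member [Y]
    of the list lowers the bound for the remaining ones to [r - 1] on the part inside [Y] and keeps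
    [r] outside. *)
Lemma count_measure_le (Ys : seq (set G)) X (r : R) :
    B X -> (forall Y, List.In Y Ys -> B Y) ->
    (forall x, X x -> (count (fun Y => x \in Y) Ys)%:R <= r) ->
  \sum_(Y <- Ys) nu (X `&` Y) <= r * nu X.
Proof.
elim: Ys X r => [|Y Ys IHYs] X r BX BYs Xr.
  rewrite big_nil; have [->|/set0P[x /Xr r0]] := eqVneq X set0.
    by rewrite finitely_additive_set0 mulr0.
  by rewrite mulr_ge0 ?nu0.
have BY : B Y by apply: BYs; left.
have BXY : B (X `&` Y) by exact: BI.
have BXnY : B (X `\` Y) by rewrite setDE; apply: BI => //; exact: BC.
have BYs' Z : List.In Z Ys -> B Z by move=> ?; apply: BYs; right.
have split_sum : \sum_(Z <- Ys) nu (X `&` Z) =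
    \sum_(Z <- Ys) nu (X `&` Y `&` Z) + \sum_(Z <- Ys) nu ((X `\` Y) `&` Z).
  elim: (Ys) BYs' => [|Z l IHl] BYs'; first by rewrite !big_nil addr0.
  rewrite !big_cons IHl; last by move=> ? ?; apply: BYs'; right.
  rewrite (@finitely_additive_split (X `&` Z) Y) //; last by apply: BI => //; apply: BYs'; left.
  have -> : (X `&` Z) `\` Y = (X `\` Y) `&` Z by rewrite !setDE setIAC.
  by rewrite setIAC; ring.
have := IHYs (X `&` Y) (r - 1) BXY BYs' _; have := IHYs (X `\` Y) r BXnY BYs' _.
rewrite big_cons split_sum (finitely_additive_split BX BY) => le2 le1.
have {}le1 : \sum_(Z <- Ys) nu (X `&` Y `&` Z) <= (r - 1) * nu (X `&` Y).
  apply: le1 => x [Xx Yx]; have := Xr _ Xx => /=.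
  by rewrite (mem_set Yx) natrD lerBrDl.
have {}le2 : \sum_(Z <- Ys) nu ((X `\` Y) `&` Z) <= r * nu (X `\` Y).
  by apply: le2 => x [Xx nYx]; have := Xr _ Xx => /=; rewrite (memNset nYx) add0n.
by rewrite mulrDr; move: le1 le2; rewrite mulrBl mul1r; lra.
Qed.

(** The upper bound, applied to the complements of the listed sets. *)
Lemma count_measure_ge (Ys : seq (set G)) X (r : R) :
    B X -> (forall Y, List.In Y Ys -> B Y) ->
    (forall x, X x -> r <= (count (fun Y => x \in Y) Ys)%:R) ->
  r * nu X <= \sum_(Y <- Ys) nu (X `&` Y).
Proof.
move=> BX BYs Xr.
have := @count_measure_le [seq ~` Y | Y <- Ys] X ((size Ys)%:R - r) BX _ _.
have -> : \sum_(Y <- [seq ~` Y | Y <- Ys]) nu (X `&` Y) =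
    (size Ys)%:R * nu X - \sum_(Y <- Ys) nu (X `&` Y).
  elim: (Ys) BYs => [|Y l IHl] BYs; first by rewrite !big_nil mul0r subrr.
  rewrite /= !big_cons IHl; last by move=> Z Zl; apply: BYs; right.
  have BY : B Y by apply: BYs; left.
  rewrite (finitely_additive_split BX BY) -setDE -natr1; ring.
rewrite mulrBl lerD2l lerN2; apply.
  by move=> Y /List.in_map_iff[Z [<- /BYs]]; exact: BC.
move=> x /Xr xr; rewrite count_map lerBrDr.
rewrite -(count_predC (fun Y => x \in Y) Ys) natrD addrC lerD //.
rewrite ler_nat; apply: eq_leq; apply: eq_count => Y /=.
by apply/idP/idP => [/set_mem + | + ]; [move=> nY; apply/negP => /set_mem|
  move=> /negP nY; apply: mem_set => Yx; exact/nY/mem_set].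
Qed.

Lemma invariant_measure_left_mean X (c : R) : B X -> left_mean X c -> nu X = c.
Proof.
move=> BX Xc; apply/eqP; rewrite -subr_eq0 -normr_le0; apply/ler_addgt0Pr => e e0.
have [l l0 lP] := Xc e e0.
(* A point [x] lies in the translate by [g^-1] iff [g * x] is in [X]. So these sets cover each point
   [c * size l] times up to [e * size l], while each of them has measure [nu X]. *)
pose Ys := [seq [set (g^-1 * s)%g | s in X] | g <- l].
have BYs Y : List.In Y Ys -> B Y.
  by move=> /List.in_map_iff[g [<- _]]; exact: BM.
have cE x : count (fun Y => x \in Y) Ys = count (fun g => (g * x)%g \in X) l.
  rewrite count_map; apply: eq_count => g /=; apply/idP/idP => /set_mem.
    by move=> [s Xs <-]; rewrite mulVKg; exact: mem_set.
  by move=> Xgx; apply: mem_set; exists (g * x)%g => //; rewrite mulKg.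
have sumE : \sum_(Y <- Ys) nu (setT `&` Y) = nu X * (size l)%:R.
  rewrite big_map -sum1_size natr_sum mulr_sumr; apply: eq_bigr => g _.
  by rewrite setTI nuM ?mulr1.
have ub := @count_measure_le Ys setT ((c + e) * (size l)%:R) BT BYs.
have lb := @count_measure_ge Ys setT ((c - e) * (size l)%:R) BT BYs.
rewrite nu1 !mulr1 sumE !ler_pM2r ?ltr0n // in ub lb.
rewrite add0r ler_norml lerBrDr lerBlDr addrC [e + c]addrC lb ?ub // => x _.
  by rewrite cE; have := lP x; rewrite ler_norml => /andP[_]; rewrite mulrDl lerBlDl.
by rewrite cE; have := lP x; rewrite ler_norml => /andP[+ _]; rewrite mulrBl lerBrDl.
Qed.

End InvariantMeasures.

(** * Formulas and definable sets *)

Section Formulas.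
Variable L : language.

Fixpoint term_rename (X Y : Type) (f : X -> Y) (t : term L X) : term L Y :=
  match t with
  | Var x => Var (f x)
  | App g u => App g (fun i => term_rename f (u i))
  end.

Fixpoint rename (X Y : Type) (f : X -> Y) (p : formula L X) : formula L Y :=
  match p with
  | Bot => Bot
  | Equal s t => Equal (term_rename f s) (term_rename f t)
  | Rel r u => Rel r (fun i => term_rename f (u i))
  | Imp p1 p2 => Imp (rename f p1) (rename f p2)
  | All p1 => All (rename (omap f) p1)
  end.

Lemma eval_rename (M : structure L) (X Y : Type) (f : X -> Y) (t : term L X)
    (v : Y -> M) :
  eval v (term_rename f t) = eval (v \o f) t.
Proof. by elim: t => //= g u IHu; congr fint; apply/funext. Qed.

Lemma sat_rename (M : structure L) (X Y : Type) (f : X -> Y) (p : formula L X)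
    (v : Y -> M) :
  sat (rename f p) v <-> sat p (v \o f).
Proof.
elim: p Y f v => {X} [X|X s t|X r u|X p IHp p' IHp'|X p IHp] Y f v //=.
- by rewrite !eval_rename.
- suff -> : (fun i => eval v (term_rename f (u i))) = (fun i => eval (v \o f) (u i)) by [].
  by apply/funext => i; rewrite eval_rename.
- by rewrite IHp IHp'.
have extE m : extend v m \o omap f = extend (v \o f) m.
  by apply/funext; case.
by split=> sp m; [have := sp m; rewrite IHp extE|rewrite IHp extE].
Qed.

Lemma sat_isomorphism (M N : structure L) (h : M -> N) (h' : N -> M) :
    cancel h h' -> cancel h' h ->
    (forall f u, h (fint M f u) = fint N f (h \o u)) ->
    (forall r u, rint N r (h \o u) <-> rint M r u) ->
  forall (X : Type) (p : formula L X) (v : X -> M), sat p (h \o v) <-> sat p v.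
Proof.
move=> hK h'K hf hr.
have hE X (t : term L X) (v : X -> M) : eval (h \o v) t = h (eval v t).
  by elim: t => //= g u IHu; rewrite hf; congr fint; apply/funext.
move=> X p; elim: p => {X} [X|X s t|X r u|X p IHp p' IHp'|X p IHp] v //=.
- by rewrite !hE; split=> [/(can_inj hK)|->].
- rewrite -hr; suff -> : (fun i => eval (h \o v) (u i)) = h \o (fun i => eval v (u i)) by [].
  by apply/funext => i /=; rewrite hE.
- by rewrite IHp IHp'.
have extE m : extend (h \o v) (h m) = h \o extend v m by apply/funext; case.
split=> sp m; first by apply/IHp; rewrite -extE.
by rewrite -[m]h'K extE; apply/IHp.
Qed.

Lemma term_support (X : Type) (t : term L X) : exists l : seq {classic X},
  forall (M : structure L) (v v' : X -> M),
    (forall x, x \in l -> v x = v' x) -> eval v t = eval v' t.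
Proof.
elim: t => [x|f u /choice[l lP]].
  by exists [:: (x : {classic X})] => M v v' vE; apply: vE; rewrite mem_head.
exists (flatten [seq l i | i : 'I_(farity f)]) => M v v' vE /=.
congr fint; apply/funext => i; apply: lP => x xl; apply: vE.
by apply/flattenP; exists (l i) => //; apply/mapP; exists i; rewrite ?mem_enum.
Qed.

(** Finite support allows variables to be named by all elements of [M] and a finite tuple to be
    extracted afterwards. *)
Lemma formula_support (X : Type) (p : formula L X) : exists l : seq {classic X},
  forall (M : structure L) (v v' : X -> M),
    (forall x, x \in l -> v x = v' x) -> sat p v <-> sat p v'.
Proof.
elim: p => {X} [X|X s t|X r u|X p [l lP] p' [l' lP']|X p [l lP]].
- by exists [::].
- have [l lP] := term_support s; have [l' lP'] := term_support t.
  exists (l ++ l') => M v v' vE /=.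
  rewrite (lP _ v v') ?(lP' _ v v') // => x xl; apply: vE;
    by rewrite mem_cat xl ?orbT.
- have /choice[l lP] := fun i => term_support (u i).
  exists (flatten [seq l i | i : 'I_(rarity r)]) => M v v' vE /=.
  suff -> : (fun i => eval v (u i)) = (fun i => eval v' (u i)) by [].
  apply/funext => i; apply: lP => x xl; apply: vE.
  by apply/flattenP; exists (l i) => //; apply/mapP; exists i; rewrite ?mem_enum.
- exists (l ++ l') => M v v' vE /=.
  rewrite (lP _ v v') ?(lP' _ v v') // => x xl; apply: vE;
    by rewrite mem_cat xl ?orbT.
(* Discarding [None] removes the bound variable from the support. *)
exists (pmap (fun o : {classic option X} => o : option {classic X}) l) => M v v' vE /=.
have extE m x : x \in l -> extend v m x = extend v' m x.
  case: x => //= x xl; apply: vE; rewrite mem_pmap.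
  by apply/mapP; exists (Some x : {classic option X}).
by split=> sp m; [rewrite -(lP _ _ _ (extE m))|rewrite (lP _ _ _ (extE m))].
Qed.

Definition Neg (X : Type) (p : formula L X) := Imp p Bot.
Definition Conj (X : Type) (p q : formula L X) := Neg (Imp p (Neg q)).
Definition Equiv (X : Type) (p q : formula L X) := Conj (Imp p q) (Imp q p).
Definition Ex (X : Type) (p : formula L (option X)) := Neg (All (Neg p)).

Lemma sat_Neg (M : structure L) (X : Type) (p : formula L X) (v : X -> M) :
  sat (Neg p) v <-> ~ sat p v.
Proof. by []. Qed.

Lemma sat_Conj (M : structure L) (X : Type) (p q : formula L X) (v : X -> M) :
  sat (Conj p q) v <-> sat p v /\ sat q v.
Proof. by split=> /= [npq|[sp sq]]; [split; apply: contrapT|]; tauto. Qed.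

Lemma sat_Equiv (M : structure L) (X : Type) (p q : formula L X) (v : X -> M) :
  sat (Equiv p q) v <-> (sat p v <-> sat q v).
Proof. by rewrite sat_Conj. Qed.

Lemma sat_Ex (M : structure L) (X : Type) (p : formula L (option X)) (v : X -> M) :
  sat (Ex p) v <-> exists m, sat p (extend v m).
Proof.
split=> /= [nall|[m sm] /(_ m)//]; apply: contrapT => /forallNP nex.
by apply: nall => m /nex.
Qed.

Definition drop_ord0 (X : Type) (z : X + 'I_0) : X :=
  match z with
  | inl x => x
  | inr i => False_rect X (notF (ltn_ord i))
  end.

Definition shift_ord (n : nat) (X : Type) (z : X + 'I_n.+1) : option X + 'I_n :=
  match z with
  | inl x => inl (Some x)
  | inr i => if unlift ord0 i is Some j then inr j else inl None
  end.

Fixpoint Exs (n : nat) : forall X : Type, formula L (X + 'I_n) -> formula L X :=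
  match n return forall X : Type, formula L (X + 'I_n) -> formula L X with
  | 0 => fun X p => rename (@drop_ord0 X) p
  | k.+1 => fun X p => Ex (@Exs k (option X) (rename (@shift_ord k X) p))
  end.

Lemma sat_Exs (M : structure L) (n : nat) (X : Type) (p : formula L (X + 'I_n))
    (v : X -> M) :
  sat (Exs p) v <-> exists w : 'I_n -> M, sat p (glue v w).
Proof.
elim: n X p v => [|n IHn] X p v.
  rewrite /= sat_rename.
  have fE w : v \o @drop_ord0 X = glue v w.
    by apply/funext => -[x|[i i0]] //=; exfalso; move: (i0); rewrite ltn0.
  split=> [sp|[w]]; last by rewrite -fE.
  case: (carrier_inhabited M) => m.
  by exists (fun=> m); rewrite -fE.
rewrite sat_Ex; split=> [[m /IHn[w]]|[w sp]].
  rewrite sat_rename => sp.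
  exists (fun i => if unlift ord0 i is Some j then w j else m).
  have -> : glue v (fun i => if unlift ord0 i is Some j then w j else m) =
      glue (extend v m) w \o @shift_ord n X; last by [].
  by apply/funext => -[x|i] //=; case: unliftP.
exists (w ord0); apply/IHn; exists (fun j => w (lift ord0 j)).
rewrite sat_rename.
have <- : glue v w =
    glue (extend v (w ord0)) (fun j => w (lift ord0 j)) \o @shift_ord n X; last by [].
by apply/funext => -[x|i] //=; case: unliftP => [j|] ->.
Qed.

End Formulas.

Section DefinableSets.
Variables (L : language) (M : structure L) (A : set M).
Implicit Types (X Y : set (aut A)) (s t : aut A).

Lemma sat_aut s (X : Type) (p : formula L X) (v : X -> M) :
  sat p (s \o v) <-> sat p v.
Proof.
exact: sat_isomorphism (autK s) (autVK s) (@aut_fint _ _ _ s) (@aut_rint _ _ _ s) _ _ _.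
Qed.

(** Variables are named by two copies of [M]: the left copy is read through [u], the right one as
    the elements themselves. The tuple [f] lists the elements that occur in either copy, with a
    default added so that it is never empty. *)
Lemma formula_on_tuple (p : formula L (M + M)) :
  exists n (q : formula L ('I_n + 'I_n)) (f : 'I_n -> M),
    forall u : M -> M, sat p (glue u id) <-> sat q (glue (u \o f) f).
Proof.
have [l lP] := formula_support p; have [m0] := carrier_inhabited M.
pose under (z : M + M) : {classic M} := match z with inl m => m | inr m => m end.
pose ms : seq {classic M} := [seq under z | z <- l].
pose f (i : 'I_(size ms).+1) : M := nth (m0 : {classic M}) ms i.
pose r (m : M) : 'I_(size ms).+1 := inord (index (m : {classic M}) ms).
have rK (m : M) : (m : {classic M}) \in ms -> f (r m) = m.
  by move=> mms; rewrite /f /r inordK ?nth_index // ltnS ltnW // index_mem.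
pose rr (z : M + M) := match z with inl m => inl (r m) | inr m => inr (r m) end.
exists _, (rename rr p), f => u; rewrite sat_rename; apply: lP => z zl.
have : under z \in ms by apply/(@mapP {classic (M + M)} {classic M}); exists z.
by case: (z) => m /rK /= ->.
Qed.

(** With one common type of variables, Boolean operations on definable sets become connectives.
    Parameters from [A] are absorbed into the right copy of [M]. *)
Lemma definableP X : definable X <->
  exists p : formula L (M + M), X = [set s : aut A | sat p (glue s id)].
Proof.
split=> [[n [p [b ->]]]|[p ->]].
  exists (rename (fun z : 'I_n + 'I_n + A => match z with
    | inl (inl i) => inl (b i) | inl (inr i) => inr (b i) | inr c => inr (val c) end) p).
  apply/funext => s; rewrite /= propeqE sat_rename /psat.
  suff <- : glue (glue (s \o b) b) (fun c : A => val c) = glue s id \o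
    (fun z : 'I_n + 'I_n + A => match z with
    | inl (inl i) => inl (b i) | inl (inr i) => inr (b i) | inr c => inr (val c) end) by [].
  by apply/funext => -[[i|i]|c].
have [n [q [f qP]]] := formula_on_tuple p.
exists n, (rename inl q), f; apply/funext => s; rewrite /= propeqE /psat sat_rename.
exact: qP.
Qed.

Lemma definable_tuple X : definable X -> exists n (p : formula L ('I_n + 'I_n)) f,
  X = [set s : aut A | sat p (glue (s \o f) f)].
Proof.
move=> /definableP[p ->]; have [n [q [f qP]]] := formula_on_tuple p.
by exists n, q, f; apply/funext => s; rewrite /= propeqE; exact: qP.
Qed.

Lemma definable_set0 : definable (set0 : set (aut A)).
Proof. by apply/definableP; exists Bot. Qed.

Lemma definable_imp X Y : definable X -> definable Y ->
  definable [set s | X s -> Y s].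
Proof. by move=> /definableP[p ->] /definableP[q ->]; apply/definableP; exists (Imp p q). Qed.

Lemma definableC X : definable X -> definable (~` X).
Proof. by move=> dX; exact: definable_imp dX definable_set0. Qed.

Lemma definableT : definable [set: aut A].
Proof. by rewrite -setC0; exact/definableC/definable_set0. Qed.

Lemma definableU X Y : definable X -> definable Y -> definable (X `|` Y).
Proof.
move=> dX dY; have := definable_imp (definableC dX) dY; congr definable.
apply/funext => s; rewrite propeqE /setU /setC /=; split; last by tauto.
by have [] := pselect (X s); tauto.
Qed.

Lemma definableI X Y : definable X -> definable Y -> definable (X `&` Y).
Proof.
move=> dX dY; rewrite -[X `&` Y]setCK setCI.
by apply/definableC/definableU; exact: definableC.
Qed.

Lemma definable_point (m m' : M) : definable [set s : aut A | s m = m'].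
Proof.
by apply/definableP; exists (Equal (Var (inl m)) (Var (inr m'))).
Qed.

(** Applying [t] to both sides of the condition at [t^-1 * s] restores [s] in the left copy and
    moves only the elements of the right copy. *)
Lemma definable_translate t X : definable X -> definable [set (t * s)%g | s in X].
Proof.
move=> /definableP[p ->]; rewrite left_translateE; apply/definableP.
exists (rename (fun z => match z with inl m => inl m | inr m => inr (t m) end) p).
apply/funext => s; rewrite /= propeqE sat_rename -(sat_aut t).
suff -> : t \o glue (t^-1 * s)%g id = glue s id \o
  (fun z => match z with inl m => inl m | inr m => inr (t m) end) by [].
by apply/funext => -[m|m] //=; exact: autVK.
Qed.

Lemma definable_count (gs : seq (aut A)) (k : nat) X : definable X ->
  definable [set s | (k < count (fun g => (g * s)%g \in X) gs)%N].
Proof.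
move=> dX; elim: gs k => [|g gs IHgs] k.
  rewrite (_ : [set _ | _] = set0); first exact: definable_set0.
  by apply/funext => s; rewrite /= ltn0 propeqE.
have dg : definable [set s | X (g * s)%g].
  by have := definable_translate (g^-1)%g dX; rewrite left_translateE invgK.
case: k => [|k].
  have := definableU dg (IHgs 0); congr definable; apply/funext => s /=.
  rewrite propeqE; split=> [[/mem_set -> //|c0]|]; first by rewrite addn_gt0 c0 orbT.
  have [/set_mem gX|_] := boolP ((g * s)%g \in X); [by left|by rewrite add0n; right].
have := definableU (definableI dg (IHgs k)) (IHgs k.+1).
congr definable; apply/funext => s /=; rewrite propeqE; split.
  move=> [[/= /mem_set -> ]|]; first by rewrite add1n ltnS.
  by move=> /leq_trans; apply; exact: leq_addl.
have [/set_mem gX|_] := boolP ((g * s)%g \in X); last by right.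
by rewrite add1n ltnS; left.
Qed.

(** Applying [g^-1] shows that [g * s] lies in [X] iff [p] holds of [s \o f] and [g^-1 \o f]; a long
    ladder for [X] would thus give a ladder for [p] in [M]. *)
Lemma stable_definable (T : theory L) X :
  models M T -> stable T -> definable X -> stable_set X.
Proof.
move=> MT Tst /definable_tuple[n [p [f ->]]].
have [k kP] := Tst _ _ p; exists k.*2 => l /(pairwiseP (1%g, 1%g)) lP.
rewrite leqNgt; apply/negP => kl; apply: (kP M MT).
pose x := nth (1%g, 1%g) l.
(* Even positions supply the [s] and odd ones the [g], because the diagonal of the list is
   unconstrained; this costs a factor 2. The order is reversed so that [i < j] puts [g] before
   [s]. *)
exists (fun i : 'I_k => (x (k - i.+1).*2).2 \o f).
exists (fun j : 'I_k => (((x (k - j.+1).*2.+1).1^-1)%g : aut A) \o f) => i j.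
have actE (g s : aut A) : sat p (glue (s \o f) (((g^-1)%g : aut A) \o f)) <->
    (g * s)%g \in [set s : aut A | sat p (glue (s \o f) f)].
  rewrite -(sat_aut g); split=> [sp|/set_mem /= sp]; last first.
    by congr (sat p _): sp; apply/funext => -[i'|i'] //=; rewrite autVK.
  apply: mem_set => /=; congr (sat p _): sp.
  by apply/funext => -[i'|i'] //=; rewrite autVK.
rewrite actE; have ik := ltn_ord i; have jk := ltn_ord j.
have i_in : ((k - i.+1).*2 \in gtn (size l))%N.
  by rewrite inE /=; apply: leq_ltn_trans kl; rewrite leq_double leq_subr.
have j_in : ((k - j.+1).*2.+1 \in gtn (size l))%N.
  by rewrite inE /=; apply: leq_ltn_trans kl; rewrite ltn_double; lia.
have [ij|ji] := ltnP i j; split=> //.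
  have lt_ji : ((k - j.+1).*2.+1 < (k - i.+1).*2)%N.
    by rewrite -doubleS leq_double; lia.
  by have /andP[] := lP _ _ j_in i_in lt_ji.
have lt_ij : ((k - i.+1).*2 < (k - j.+1).*2.+1)%N by rewrite ltnS leq_double; lia.
by have /andP[_ /negP] := lP _ _ i_in j_in lt_ij.
Qed.

End DefinableSets.

(** The second components at two even positions are told apart by the first component at an odd
    position in between, so their values under [r] are distinct. *)
Lemma ladder_bounded_finite_range (U V : Type) (W : eqType) (E : U -> V -> bool)
    (r : V -> W) (l0 : seq W) :
  (forall v, r v \in l0) -> (forall u v v', r v = r v' -> E u v = E u v') ->
  ladder_bounded E (size l0).*2.+1.
Proof.
move=> rl0 Er l al; case: l al => [//|a l']; set l := a :: l' => /(pairwiseP a) lP.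
pose w := mkseq (fun i => r (nth a l i.*2).2) (size l)./2.
suff uw : uniq w.
  have : (size w <= size l0)%N.
    by apply: uniq_leq_size uw _ => _ /mapP[i _ ->].
  rewrite size_mkseq; move: (size l) (size l0) => m n; lia.
rewrite /w map_inj_in_uniq ?iota_uniq // => i j; rewrite !mem_iota !add0n /=.
wlog ij : i j / (i < j)%N.
  move=> H il jl ijE; have [ij|ji|//] := ltngtP i j; first exact: H.
  by apply/esym/H.
move=> il jl /Er rE; exfalso.
have lt1 : (i.*2 < i.*2.+1)%N by [].
have lt2 : (i.*2.+1 < j.*2)%N by rewrite -doubleS leq_double.
have j_in : (j.*2 \in gtn (size l))%N by rewrite inE /=; move: (size l) jl; lia.
have i_in' : (i.*2.+1 \in gtn (size l))%N by rewrite inE /=; apply: ltn_trans lt2 j_in.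
have i_in : (i.*2 \in gtn (size l))%N by rewrite inE /=; apply: ltn_trans lt1 i_in'.
have /andP[_ nE] := lP _ _ i_in i_in' lt1.
have /andP[Ej _] := lP _ _ i_in' j_in lt2.
by move: nE; rewrite rE Ej.
Qed.

Section AlgebraicStructures.
Variables (L : language) (M : structure L) (A : set M).
Lemma psat_aut (s : aut A) (X : Type) (p : pformula A X) (v : X -> M) :
  psat p (s \o v) <-> psat p v.
Proof.
rewrite /psat.
suff -> : glue (s \o v) (fun c : A => val c) = s \o glue v (fun c : A => val c).
  exact: sat_aut.
by apply/funext => -[x|c] //=; rewrite aut_fix //; exact/set_mem/valP.
Qed.

Hypothesis aclM : acl A = [set: M].

Lemma finite_orbit (m : M) : exists l : seq {classic M}, forall s : aut A, s m \in l.
Proof.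
have : acl A m by rewrite aclM.
move=> [p [pm fin]].
have [l lE] := (@finite_seqP {classic M} _).1 fin; exists l => s.
have : [set c | psat p (fun=> c)] (s m) by exact: (psat_aut s p (fun=> m)).2.
by rewrite lE.
Qed.

(** For fixed [g], whether [g * s] is in [X] depends only on [s \o f], which takes finitely many
    values since orbits are finite. *)
Lemma algebraic_definable (X : set (aut A)) : definable X -> stable_set X.
Proof.
move=> /definable_tuple[n [p [f ->]]].
have /choice[l lP] := finite_orbit.
pose big : seq {classic M} := flatten [seq l (f i) | i : 'I_n].
have sbig (s : aut A) i : (s (f i) : {classic M}) \in big.
  by apply/flattenP; exists (l (f i)) => //; apply/mapP; exists i; rewrite ?mem_enum.
pose W := {classic ('I_n -> M)}.
pose r (s : aut A) : W := s \o f.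
pose l0 : seq W := [seq (fun i => val (h i)) | h : {ffun 'I_n -> seq_sub big}].
exists (size l0).*2.+1; apply: (@ladder_bounded_finite_range _ _ W _ r).
  move=> s; apply/mapP; exists [ffun i => SeqSub (sbig s i)]; first by rewrite mem_enum.
  by apply/funext => i; rewrite ffunE.
move=> g s s' ss'; have gss' : (g * s)%g \o f = (g * s')%g \o f.
  apply/funext => i /=; congr (g _); exact: (congr1 (fun h : 'I_n -> M => h i) ss').
by apply/idP/idP => /set_mem /= sp; apply: mem_set; rewrite /= ?gss' // -gss'.
Qed.

End AlgebraicStructures.

(** * The invariant Keisler measure *)

Section KeislerExistence.
Variables (R : realType) (L : language) (M : structure L) (A : set M).
Hypothesis defst : forall X : set (aut A), definable X -> stable_set X.
Local Open Scope ring_scope.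

(** The default 0 is taken only by sets without a left mean; stable sets always have one. *)
Definition mean (X : set (aut A)) : R := xget 0 [set c | left_mean X c].

Lemma meanP (X : set (aut A)) : definable X -> left_mean X (mean X).
Proof.
move=> /defst/(left_mean_exists R)[c Xc]; rewrite /mean.
by case: xgetP => [d _ //|/(_ c)].
Qed.

Lemma mean_eq (X : set (aut A)) (c : R) : definable X -> left_mean X c -> mean X = c.
Proof. by move=> dX; apply: left_mean_unique (defst dX) (meanP dX). Qed.

Lemma unique_invariant_keisler_mean : unique_invariant_keisler mean.
Proof.
split.
  split; first split.
  - by move=> X dX; exact: left_mean_ge0 (meanP dX).
  - apply: mean_eq; first exact: definableT.
    by apply: (@left_mean_const _ _ _ _ true) => // s; exact: mem_set.
  - move=> X Y dX dY XY0.
    (* Left means are unique, so those of [X] and [Y] may be computed along a common ultrafilter. *)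
    have [c [d [Xc Yd XYcd]]] := left_mean_exists2 R (defst dX) (defst dY) XY0.
    rewrite (mean_eq dX Xc) (mean_eq dY Yd); apply: mean_eq; first exact: definableU.
    exact/XYcd/defst/definableU.
  - move=> t X dX; apply: mean_eq; first exact: definable_translate.
    exact/left_mean_translate/meanP.
move=> nu [[nu0 nu1 nuU] nuM] X dX.
apply: (@invariant_measure_left_mean _ _ (@definable L M A)) => //.
- exact: definableT.
- exact: definableI.
- exact: definableC.
- exact: definable_translate.
- exact: meanP.
Qed.

End KeislerExistence.

(** * Algebraic closure in T^eq *)

Section Imaginaries.
Variables (L : language) (T : theory L).

Section UniformEqrel.
Variables (n d : nat) (W : formula L ('I_n + 'I_d)).

(** The classes of this relation are the canonical parameters of the instances of [W]. *)
Definition same_fiber_formula : formula L ('I_d + 'I_d) :=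
  Neg (Exs (Neg (Equiv
    (rename (fun z : 'I_n + 'I_d => match z with
      | inl x => inr x | inr e => inl (inl e) end) W)
    (rename (fun z : 'I_n + 'I_d => match z with
      | inl x => inr x | inr e => inl (inr e) end) W)))).

Lemma sat_same_fiber (N : structure L) (a b : 'I_d -> N) :
  sat same_fiber_formula (glue a b) <->
  forall x : 'I_n -> N, sat W (glue x a) <-> sat W (glue x b).
Proof.
rewrite /same_fiber_formula sat_Neg sat_Exs.
have eqv x : sat (Equiv
    (rename (fun z : 'I_n + 'I_d => match z with
      | inl x => inr x | inr e => inl (inl e) end) W)
    (rename (fun z : 'I_n + 'I_d => match z with
      | inl x => inr x | inr e => inl (inr e) end) W)) (glue (glue a b) x) <->
    (sat W (glue x a) <-> sat W (glue x b)).
  rewrite sat_Equiv !sat_rename.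
  have comp1 : glue (glue a b) x \o (fun z : 'I_n + 'I_d => match z with
      | inl x => inr x | inr e => inl (inl e) end) = glue x a.
    by apply/funext => -[].
  have comp2 : glue (glue a b) x \o (fun z : 'I_n + 'I_d => match z with
      | inl x => inr x | inr e => inl (inr e) end) = glue x b.
    by apply/funext => -[].
  by rewrite comp1 comp2.
split=> [nex x|all [x nx]]; last by apply: nx; exact/eqv.
by apply/eqv; apply: contrapT => nx; apply: nex; exists x.
Qed.

Lemma same_fiber_equivalence (N : structure L) : models N T ->
  RelationClasses.Equivalence
    (fun a b : 'I_d -> N => sat same_fiber_formula (glue a b)).
Proof.
move=> _; split.
- by move=> a; apply/sat_same_fiber.
- by move=> a b /sat_same_fiber ab; apply/sat_same_fiber => x; rewrite ab.
- move=> a b c /sat_same_fiber ab /sat_same_fiber bc; apply/sat_same_fiber => x.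
  by rewrite ab.
Qed.

Definition same_fiber : eqrel T := @Eqrel L T d same_fiber_formula same_fiber_equivalence.

End UniformEqrel.

Variables (M : structure L) (A : set M).

Lemma imaginary_eq (E : eqrel T) (c c' : set ('I_(edim E) -> M)) p p' :
  c = c' -> @Imaginary L T M E c p = @Imaginary L T M E c' p'.
Proof. by move=> cc'; subst c'; congr Imaginary; exact: Prop_irrelevance. Qed.

Lemma proj_inj (E : eqrel T) (a b : 'I_(edim E) -> M) :
  proj a = proj b -> eclass a = eclass b.
Proof.
move=> [e].
(* The class is a dependent component over its sort; classical decidability of equality of sorts
   makes it injective. *)
exact: (Eqdep_dec.inj_pair2_eq_dec _ (fun E E' : eqrel T => pselect (E = E')) _ _ _ _ e).
Qed.

Lemma aut_class (s : aut A) (E : eqrel T) (c : set ('I_(edim E) -> M)) :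
  (exists a, c = eclass a) ->
  exists a, [set b : 'I_(edim E) -> M | c (aut_inv s \o b)] = @eclass L T M E a.
Proof.
move=> [a ->]; exists (s \o a); apply/funext => b; rewrite /eclass /= propeqE.
rewrite -(sat_aut s); suff -> : s \o glue a (aut_inv s \o b) = glue (s \o a) b by [].
by apply/funext => -[i|i] //=; rewrite autVK.
Qed.

Definition aut_imaginary (s : aut A) (z : imaginary T M) : imaginary T M :=
  Imaginary (aut_class s (iclassP z)).

Definition aut_eq_carrier (s : aut A) (z : eq_structure T M) : eq_structure T M :=
  match z with inl m => inl (s m) | inr i => inr (aut_imaginary s i) end.

Lemma aut_proj (s : aut A) (E : eqrel T) (a : 'I_(edim E) -> M) :
  aut_imaginary s (proj a) = proj (s \o a).
Proof.
apply: imaginary_eq; apply/funext => b; rewrite /= /eclass /= propeqE.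
rewrite -(sat_aut s); suff -> : s \o glue a (aut_inv s \o b) = glue (s \o a) b by [].
by apply/funext => -[i|i] //=; rewrite autVK.
Qed.

Lemma imaginary_proj (z : imaginary T M) : exists E (a : 'I_(edim E) -> M), z = proj a.
Proof. by case: z => E c [a ca]; exists E, a; exact: imaginary_eq. Qed.

Lemma aut_eq_carrierK (s : aut A) : cancel (aut_eq_carrier s) (aut_eq_carrier (s^-1)%g).
Proof.
move=> [m|z] /=; first by congr inl; exact: autK.
have [E [a ->]] := imaginary_proj z; rewrite !aut_proj.
by congr (inr (proj _)); apply/funext => i; exact: autK.
Qed.

Lemma aut_eq_rint (s : aut A) (r : rsym (eq_language T)) (u : 'I_(rarity r) -> eq_structure T M) :
  rint (eq_structure T M) r u -> rint (eq_structure T M) r (aut_eq_carrier s \o u).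
Proof.
case: r u => [|E|r|f|E] u /=.
- by move=> [m um]; exists (s m); rewrite um.
- by move=> [a ua]; exists (s \o a); rewrite ua /= aut_proj.
- move=> [a ua ra]; exists (s \o a); first by move=> i; rewrite ua.
  exact/aut_rint.
- move=> [a ua fa]; exists (s \o a); first by move=> i; rewrite ua.
  by rewrite fa /= aut_fint.
- move=> [a ua fa]; exists (s \o a); first by move=> i; rewrite ua.
  by rewrite fa /= aut_proj.
Qed.

Lemma sat_aut_eq (s : aut A) (X : Type) (p : formula (eq_language T) X)
    (v : X -> eq_structure T M) :
  sat p (aut_eq_carrier s \o v) <-> sat p v.
Proof.
have K' : cancel (aut_eq_carrier (s^-1)%g) (aut_eq_carrier s).
  by move=> z; have := aut_eq_carrierK (s^-1)%g z; rewrite invgK.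
apply: (@sat_isomorphism _ _ _ _ _ (aut_eq_carrierK s) K') => [[]//|r u].
split=> [/(aut_eq_rint (s^-1)%g)|/aut_eq_rint//].
congr (rint _ _ _); apply/funext => i /=; exact: aut_eq_carrierK.
Qed.

Lemma dcl_aut_fixed (s : aut A) (z : eq_structure T M) :
  dcl (@real L T M @` A) z -> aut_eq_carrier s z = z.
Proof.
move=> [p pz]; have : [set z] (aut_eq_carrier s z); last by [].
rewrite -pz /=.
have : [set c | psat p (fun=> c)] z by rewrite pz.
rewrite /= /psat -(sat_aut_eq s); congr (sat p _).
apply/funext => -[//|c] /=.
by have /set_mem[m Am <-] := valP c; rewrite /= aut_fix.
Qed.

End Imaginaries.

Lemma formula_on_parameters (L : language) (Y Z : Type) (p : formula L (Y + Z)) :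
  exists m (g : 'I_m -> Z) (q : formula L (Y + 'I_m)),
    forall (M : structure L) (u : Y -> M) (v : Z -> M),
      sat q (glue u (v \o g)) <-> sat p (glue u v).
Proof.
have [[z0]|Z0] := pselect (inhabited Z); last first.
  have Zf (z : Z) : False by apply: Z0; exact: inhabits.
  exists 0, (fun i : 'I_0 => False_rect Z (notF (ltn_ord i))),
    (rename (fun x : Y + Z => match x with
       | inl y => inl y | inr z => False_rect _ (Zf z) end) p) => M u v.
  rewrite sat_rename; set v' := (X in sat p X <-> _).
  suff -> : v' = glue u v by [].
  by apply/funext => -[y|z] //; case: (Zf z).
have [l lP] := formula_support p.
pose zs : seq {classic Z} := pmap (fun x : {classic (Y + Z)} =>
  match (x : Y + Z) with inl _ => None | inr z => Some (z : {classic Z}) end) l.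
pose g (i : 'I_(size zs).+1) : Z := nth (z0 : {classic Z}) zs i.
pose r (z : Z) : 'I_(size zs).+1 := inord (index (z : {classic Z}) zs).
exists _, g, (rename (fun x => match x with inl y => inl y | inr z => inr (r z) end) p).
move=> M u v; rewrite sat_rename; apply: lP => -[y|z] zl //=.
have zzs : (z : {classic Z}) \in zs.
  by rewrite mem_pmap; apply/mapP; exists (inr z : {classic (Y + Z)}).
by rewrite /g /r inordK ?nth_index // ltnS ltnW // index_mem.
Qed.

Section AlgebraicallyClosed.
Variables (L : language) (T : theory L) (M : structure L) (A : set M).

(** A realization of the isolating formula has the same type as [f], so by homogeneity [psi] defines
    the orbit of [f]. *)
Lemma isolated_orbit (n : nat) (f c : 'I_n -> M) (psi : pformula A 'I_n) :
    strongly_homogeneous A -> tp A f psi ->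
    (forall q, tp A f q -> forall c, psat psi c -> psat q c) ->
  psat psi c -> exists s : aut A, s \o f = c.
Proof.
move=> hom fpsi isol cpsi; apply: hom; apply/seteqP; split=> q fq.
  exact: isol cpsi.
apply: contrapT => nfq.
have /isol/(_ _ cpsi) : tp A f (Neg q) by [].
exact.
Qed.

(* The formula W below also requires psi at the parameter y: all tuples that are
   not conjugate to f then fall into one class, so that the imaginaries of the
   form (y, g)/E are finite in number and no formula of L has to be translated
   to L^eq. *)
Lemma eq_acl_closed_fixed (D : set (aut A)) (l : seq (aut A))
    (tau : aut A -> aut A -> bool) :
    atomic A -> strongly_homogeneous A -> eq_acl_closed T A -> definable D ->
    (forall u, exists2 t, t \in l & forall s, ((u * s)%g \in D) = tau t s) ->
  forall u s, ((u * s)%g \in D) = (s \in D).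
Proof.
move=> atom hom aclA /definable_tuple[n [p [f DE]]] Dl.
have [psi fpsi isol] := atom _ f.
have orb c : psat psi c -> exists s : aut A, s \o f = c by exact: isolated_orbit.
have [m [g [q qP]]] := formula_on_parameters psi.
pose W : formula L ('I_n + 'I_(n + m)) := Conj
  (rename (fun z => match z with inl i => inr (lshift m i) | inr j => inr (rshift n j) end) q)
  (Conj (rename (fun z => match z with inl i => inl i | inr j => inr (rshift n j) end) q)
     (rename (fun z => match z with inl i => inl i | inr i => inr (lshift m i) end) p)).
pose tup (y : 'I_n -> M) (k : 'I_(n + m)) : M :=
  match fintype.split k with inl i => y i | inr j => val (g j) end.
have tupl y i : tup y (lshift m i) = y i.
  by rewrite /tup; have -> := unsplitK (inl i : 'I_n + 'I_m).
have tupr y j : tup y (rshift n j) = val (g j).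
  by rewrite /tup; have -> := unsplitK (inr j : 'I_n + 'I_m).
have WP x y : sat W (glue x (tup y)) <-> [/\ psat psi y, psat psi x & sat p (glue x y)].
  rewrite !sat_Conj !sat_rename.
  have -> : glue x (tup y) \o (fun z => match z with
      inl i => inr (lshift m i) | inr j => inr (rshift n j) end) = glue y (val \o g).
    by apply/funext => -[i|j] /=; rewrite ?tupl ?tupr.
  have -> : glue x (tup y) \o (fun z => match z with
      inl i => inl i | inr j => inr (rshift n j) end) = glue x (val \o g).
    by apply/funext => -[i|j] //=; rewrite ?tupr.
  have -> : glue x (tup y) \o (fun z => match z with
      inl i => inl i | inr i => inr (lshift m i) end) = glue x y.
    by apply/funext => -[i|j] //=; rewrite ?tupl.
  rewrite !qP; split=> [[? []]|[]] //.
pose E := same_fiber T W.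
(* [key y] is the translate of [D] coded by the imaginary of [tup y]: it is u D for [y = u \o f],
   and empty if [y] is not conjugate to [f]. *)
pose key y : set (aut A) := [set s : aut A | psat psi y /\ sat p (glue (s \o f) y)].
have keyP y y' : key y = key y' -> @proj _ T M E (tup y) = @proj _ T M E (tup y').
  move=> /seteqP[k1 k2]; apply: imaginary_eq.
  have WE x : sat W (glue x (tup y)) <-> sat W (glue x (tup y')).
    rewrite !WP; split=> -[psiy psix xy]; have [s sx] := orb _ psix.
      by have [?] : key y' s; [apply: k1; split; rewrite ?sx|rewrite sx].
    by have [?] : key y s; [apply: k2; split; rewrite ?sx|rewrite sx].
  apply/funext => b; rewrite /eclass /= propeqE.
  split=> /(@sat_same_fiber L _ _ W) eb; apply/(@sat_same_fiber L _ _ W) => x.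
    by rewrite -eb WE.
  by rewrite -eb WE.
have key_aut (u : aut A) : key (u \o f) = [set s : aut A | (u^-1 * s)%g \in D].
  apply/funext => s; rewrite /key /= propeqE DE.
  have sE : sat p (glue (s \o f) (u \o f)) <-> sat p (glue (((u^-1 * s)%g : aut A) \o f) f).
    rewrite -(sat_aut u p (glue (((u^-1 * s)%g : aut A) \o f) f)).
    suff -> : u \o glue (((u^-1 * s)%g : aut A) \o f) f = glue (s \o f) (u \o f) by [].
    by apply/funext => -[i|i] //=; rewrite autVK.
  rewrite sE psat_aut; split=> [[_ ?]|/set_mem ?]; last by split.
  exact: mem_set.
have key_fin : finite_set [set k | exists y, k = key y].
  apply: (@sub_finite_set _ _ ([set set0] `|` [set [set s : aut A | tau t s] | t in [set` l]])).
    move=> _ [y ->]; have [psiy|npsiy] := pselect (psat psi y); last first.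
      by left; apply/seteqP; split=> s // [].
    right; have [u <-] := orb _ psiy; have [t tl tE] := Dl (u^-1)%g.
    by exists t => //; rewrite key_aut; apply/funext => s /=; rewrite tE.
  by rewrite finite_setU; split=> //; apply: finite_image; exact: finite_seq.
pose z0 : eq_structure T M := inr (@proj _ T M E (tup f)).
have z0_acl : acl (@real L T M @` A) z0.
  pose A' := @real L T M @` A.
  have gA j : A' (real T (val (g j))) by exists (val (g j)) => //; exact/set_mem/valP.
  pose g' j : A' := SigSub (mem_set (gA j)).
  pose args (i : 'I_(n + m).+1) : term (eq_language T) (unit + A' + 'I_n) :=
    match unlift ord0 i with
    | None => Var (inl (inl tt))
    | Some k => match fintype.split k with
      | inl i => Var (inr i) | inr j => Var (inl (inr (g' j))) end
    end.
  (* The algebraic formula says that the element is the projection of (y, g) for some [y], with [g]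
     the parameters of [psi]. Its solutions are finite in number because each is determined by a
     key. *)
  exists (Exs (@Rel (eq_language T) _ (Proj E) args)); split.
    apply/sat_Exs; exists (fun i => inl (f i)); exists (tup f) => [k|] /=.
      by rewrite /args liftK /tup; case: (fintype.split k).
    by rewrite /args unlift_none.
  have /choice[F FP] : forall k, exists z : imaginary T M,
      forall y, key y = k -> @proj _ T M E (tup y) = z.
    move=> k; have [[y yk]|nk] := pselect (exists y, key y = k); last first.
      by exists (@proj _ T M E (tup f)) => y yk; exfalso; apply: nk; exists y.
    by exists (@proj _ T M E (tup y)) => y' y'k; apply: keyP; rewrite yk.
  apply: (@sub_finite_set _ _ ((fun k => inr (F k) : eq_structure T M) @`
      [set k | exists y, k = key y])); last exact: finite_image.
  move=> z /sat_Exs[w [a wa za]].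
  pose y i := a (lshift m i).
  have aE : a = tup y.
    apply/funext => k; have := wa k; rewrite /= /args liftK /tup.
    by case: split_ordP => j -> //= [].
  exists (key y); first by exists y.
  move: za; rewrite /= /args unlift_none /= => ->; congr inr.
  by rewrite aE; exact/esym/FP.
move: z0_acl; rewrite aclA => z0_dcl.
have tup_aut (u : aut A) : u \o tup f = tup (u \o f).
  apply/funext => k; rewrite /tup /=; case: (fintype.split k) => // j.
  by rewrite aut_fix //; exact/set_mem/valP.
(* The imaginary of [tup f] is definable over [A], hence fixed by every [u], which means that
   [tup (u \o f)] and [tup f] define the same fibre of [W]. *)
have tup_class (u : aut A) : @eclass L T M E (tup (u \o f)) = @eclass L T M E (tup f).
  apply: proj_inj; rewrite -tup_aut -aut_proj.
  exact: (congr1 (fun z : eq_structure T M =>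
    if z is inr i then i else @proj _ T M E (tup f)) (dcl_aut_fixed u z0_dcl)).
move=> u s; have := tup_class (u^-1)%g => /seteqP[_ /(_ (tup f))].
have refl_f : @eclass L T M E (tup f) (tup f) by apply/(@sat_same_fiber L _ _ W).
move=> /(_ refl_f)/(@sat_same_fiber L _ _ W) WE.
have psx : psat psi (s \o f) by apply/psat_aut.
have psu : psat psi (((u^-1)%g : aut A) \o f) by apply/psat_aut.
have Du : (u * s)%g \in D = `[< sat p (glue (s \o f) (((u^-1)%g : aut A) \o f)) >].
  have : key (((u^-1)%g : aut A) \o f) s <-> (u * s)%g \in D by rewrite key_aut invgK.
  by move=> kD; apply/idP/asboolP => [/kD[]//|sp]; apply/kD.
rewrite Du; apply/asboolP/idP => [sp|/set_mem].
  have [_ _] : [/\ psat psi f, psat psi (s \o f) & sat p (glue (s \o f) f)].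
    by apply/WP/WE/WP.
  by move=> sf; apply: mem_set; rewrite DE.
rewrite DE => /= sf.
by have [] : [/\ psat psi (((u^-1)%g : aut A) \o f), psat psi (s \o f)
  & sat p (glue (s \o f) (((u^-1)%g : aut A) \o f))] by apply/WP/WE/WP.
Qed.

End AlgebraicallyClosed.

(** * The topology of the automorphism group *)

Section AutTopology.
Variables (L : language) (M : structure L) (A : set M).
Implicit Types (s t : aut A) (U : set (aut A)).

Let ptw := {ptws {classic M} -> discrete_topology {classic M}}.
Let to_ptw (s : aut A) : ptw := aut_fun s.

Lemma aut_cvg (F : set_system (aut A)) s : Filter F ->
  (forall m, F [set t : aut A | t m = s m]) -> F --> s.
Proof.
move=> FF Fm U [B [[C oC CB] Bs BU]].
have : to_ptw @ F --> to_ptw s.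
  apply/cvg_sup => m V [D [[W oW WD] Ds DV]].
  rewrite nbhs_filterE /=; apply: filterS (Fm m) => t tm /=.
  by apply: DV; move: Ds; rewrite -WD /= /to_ptw tm.
move=> /(_ C); rewrite nbhs_filterE => FC; apply: filterS BU _; rewrite -CB; apply: FC.
by apply: open_nbhs_nbhs; split => //; move: Bs; rewrite -CB.
Qed.

Lemma nbhs_aut_point s (m : M) : nbhs s [set t : aut A | t m = s m].
Proof.
have pc : continuous (fun f : ptw => (f m : discrete_topology {classic M})).
  exact: (@proj_continuous {classic M} (fun=> discrete_topology {classic M}) m).
have ac : continuous to_ptw by exact: initial_continuous.
have sm : nbhs (s m : discrete_topology {classic M}) [set s m : discrete_topology {classic M}].
  exact: discrete_set1.
exact: ac (pc (to_ptw s) _ sm).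
Qed.

Lemma nbhs_aut s U : nbhs s U -> exists l : seq {classic M},
  forall t, (forall m, m \in l -> t m = s m) -> U t.
Proof.
(* The sets that contain a cylinder around [s] form a filter; by the convergence criterion it
   converges to [s], so it contains every neighbourhood of [s]. *)
pose N : set_system (aut A) := [set V : set (aut A) | exists l : seq {classic M},
  forall t, (forall m, m \in l -> t m = s m) -> V t].
suff Ns : N --> s by move=> /Ns.
apply: aut_cvg => [|m]; last first.
  by exists [:: (m : {classic M})] => t; apply; rewrite mem_head.
split.
- by exists [::].
- move=> V W [l lV] [l' l'W]; exists (l ++ l') => t tE; split.
    by apply: lV => m ml; apply: tE; rewrite mem_cat ml.
  by apply: l'W => m ml; apply: tE; rewrite mem_cat ml orbT.
- by move=> V W VW [l lV]; exists l => t /lV/VW.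
Qed.

Lemma clopen_point (m m' : M) : clopen [set s : aut A | s m = m'].
Proof.
split.
  by rewrite openE => s /= sm; rewrite /interior -sm; exact: nbhs_aut_point.
rewrite -[X in closed X]setCK; apply: open_closedC; rewrite openE => s /= sm.
by rewrite /interior; apply: filterS (nbhs_aut_point s m) => t /= ->.
Qed.

Lemma aut_zero_dimensional : zero_dimensional (aut A).
Proof.
move=> s t /eqP st; have /existsNP[m sm] : ~ forall m, s m = t m.
  by move=> E; apply: st; exact: aut_eq.
exists [set u : aut A | u m = s m]; split=> //; first exact: clopen_point.
by move=> /= tm; apply: sm.
Qed.

Lemma aut_topological_group : topological_group (aut A).
Proof.
split.
  move=> [s t]; apply: aut_cvg => m /=.
  exists ([set u : aut A | u (t m) = s (t m)], [set u : aut A | u m = t m]) => /=.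
    by split; exact: nbhs_aut_point.
  by move=> [u v] /= [us vt]; rewrite vt.
suff inv_cvg (s : aut A) : (@aut_opp L M A) @ s --> (aut_opp s : aut A).
  by move=> s; exact: inv_cvg.
have F_filter := fmap_filter (@aut_opp L M A) (nbhs_filter s).
apply: aut_cvg => m /=; apply: filterS (nbhs_aut_point s (aut_inv s m)) => t /= ts.
by rewrite -{1}[m](autVK s) -ts autK.
Qed.

Lemma definable_clopen U : definable U -> clopen U.
Proof.
move=> /definable_tuple[n [p [f ->]]].
have dep (V : set ('I_n -> M)) : open [set s : aut A | V (s \o f)].
  rewrite openE => s /= Vs; rewrite /interior.
  have nf : nbhs s [set t : aut A | forall i, t (f i) = s (f i)].
    exact: (@filter_forall _ _ (fun i (t : aut A) => t (f i) = s (f i)) _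
      (nbhs_filter s) (fun i => nbhs_aut_point s (f i))).
  apply: filterS nf => t tE; congr (V _): Vs.
  by apply/funext => i /=; rewrite tE.
split; first exact: (dep [set x | sat p (glue x f)]).
rewrite -[X in closed X]setCK; apply: open_closedC.
exact: (dep [set x | ~ sat p (glue x f)]).
Qed.

End AutTopology.

Section ProfiniteAut.
Variables (L : language) (M : structure L) (A : set M).
Hypothesis aclM : acl A = [set: M].

(** Orbits are finite, so along an ultrafilter the value at each [m] is almost surely constant. The
    limits of the automorphisms and of their inverses are mutually inverse maps, and each instance
    of preserving the structure involves finitely many elements only. *)
Lemma aut_compact : compact [set: aut A].
Proof.
rewrite compact_ultra => F FU _.
have /choice[l lP] := finite_orbit aclM.
have lim m : exists m', F [set s : aut A | s m = m'].
  have [|m' _ Fm'] := @ultra_seq_bigcup _ F {classic M} (l m)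
      (fun m' => [set s : aut A | s m = m']) FU; last by exists m'.
  by apply: filterS filterT => s _; exists (s m).
have lim' m : exists m', F [set s : aut A | aut_inv s m = m'].
  have [|m' _ Fm'] := @ultra_seq_bigcup _ F {classic M} (l m)
      (fun m' => [set s : aut A | aut_inv s m = m']) FU; last by exists m'.
  by apply: filterS filterT => s _; exists (aut_inv s m) => //; exact: (lP m (s^-1)%g).
have {lim}/choice[f fP] := lim; have {lim'}/choice[g gP] := lim'.
have fK : cancel f g.
  by move=> m; have [s [/= <- <-]] := filter_ex (filterI (fP m) (gP (f m))); rewrite autK.
have gK : cancel g f.
  by move=> m; have [s [/= <- <-]] := filter_ex (filterI (gP m) (fP (g m))); rewrite autVK.
have Ftup n (u : 'I_n -> M) : F [set s : aut A | s \o u = f \o u].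
  have Fu : F [set s : aut A | forall i, s (u i) = f (u i)].
    exact: (@filter_forall _ _ (fun i (s : aut A) => s (u i) = f (u i)) F _
      (fun i => fP (u i))).
  by apply: filterS Fu => s sE; apply/funext => i /=; exact: sE.
have f_fint h (u : 'I_(farity h) -> M) : f (fint M h u) = fint M h (f \o u).
  have [s [/= <- <-]] := filter_ex (filterI (fP (fint M h u)) (Ftup _ u)).
  exact: aut_fint.
have f_rint r (u : 'I_(rarity r) -> M) : rint M r (f \o u) <-> rint M r u.
  have [s /= <-] := filter_ex (Ftup _ u).
  exact: aut_rint.
have f_fix m : A m -> f m = m.
  by move=> Am; have [s /= <-] := filter_ex (fP m); exact: aut_fix.
exists (Aut fK gK f_fint f_rint f_fix); split=> //=.
by apply: aut_cvg => m; exact: fP.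
Qed.

Lemma aut_profinite : profinite (aut A).
Proof.
split; first exact: aut_topological_group.
- exact: aut_compact.
- move=> s t st; apply: aut_eq => m.
  by have [u [/= <- <-]] := st _ _ (nbhs_aut_point s m) (nbhs_aut_point t m).
- exact: zero_dimension_totally_disconnected (@aut_zero_dimensional _ _ _).
Qed.

End ProfiniteAut.

(** * Extension of a content on clopen sets to a Haar measure *)

Section ContentExtension.
Variables (G : preTopologicalGroupType) (R : realType) (m : set G -> R).
Implicit Types (B C D U V W : set G).
Hypothesis cG : compact [set: G].
Hypothesis clopen_base : forall U (s : G), open U -> U s ->
  exists2 C, clopen C & C s /\ C `<=` U.
Hypothesis m_ge0 : forall C, clopen C -> (0 <= m C)%R.
Hypothesis mT : m setT = 1%R.
Hypothesis mU : forall C D, clopen C -> clopen D -> C `&` D = set0 ->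
  m (C `|` D) = (m C + m D)%R.
Local Open Scope ereal_scope.

Lemma clopenD C D : clopen C -> clopen D -> clopen (C `\` D).
Proof. by move=> cC cD; rewrite setDE; apply: clopenI => //; exact: clopenC. Qed.

Lemma content_set0 : m set0 = 0%R.
Proof.
have := mU clopen0 clopen0 (setI0 _); rewrite setU0 => /eqP.
by rewrite addrC -subr_eq subrr => /eqP.
Qed.

Lemma content_split C D : clopen C -> clopen D -> m C = (m (C `&` D) + m (C `\` D))%R.
Proof.
move=> cC cD; rewrite -mU ?setUIDK //; [exact: clopenI|exact: clopenD|].
by rewrite setDE setICA -setIA setICr !setI0.
Qed.

Lemma content_le C D : clopen C -> clopen D -> C `<=` D -> (m C <= m D)%R.
Proof.
move=> cC cD CD; rewrite (content_split cD cC) (setIidr CD) lerDl.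
exact/m_ge0/clopenD.
Qed.

Lemma clopen_between K V : closed K -> open V -> K `<=` V ->
  exists2 E, clopen E & K `<=` E /\ E `<=` V.
Proof.
move=> cK oV KV; have : compact K by exact: subclosed_compact cK cG _.
rewrite compact_cover.
move=> /(_ {classic set G} [set E | clopen E /\ E `<=` V] id) [|s Ks|D' D'E KD'].
- by move=> E [[]].
- have [C cC [Cs CV]] := clopen_base oV (KV _ Ks); exists C => //.
exists (cover [set` D'] id); last first.
  split=> // s [E /= ED' Es]; have /set_mem[_] := D'E _ ED'; exact.
split.
  by apply: bigcup_open => E /= ED'; have /set_mem[[]] := D'E _ ED'.
apply: closed_bigcup => [|E /= ED']; first exact: finite_fset.
by have /set_mem[[]] := D'E _ ED'.
Qed.

Definition inner_content U : \bar R :=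
  ereal_sup [set (m C)%:E | C in [set C | clopen C /\ C `<=` U]].

Lemma inner_content_ge C U : clopen C -> C `<=` U -> (m C)%:E <= inner_content U.
Proof. by move=> cC CU; apply: ereal_sup_ubound; exists C. Qed.

Lemma inner_content_ge0 U : 0 <= inner_content U.
Proof. by rewrite -[0]/(0%R%:E) -content_set0; apply: inner_content_ge => //; exact: clopen0. Qed.

Lemma inner_content_le U V : U `<=` V -> inner_content U <= inner_content V.
Proof.
move=> UV; apply: ge_ereal_sup => _ [C [cC CU] <-].
by apply: inner_content_ge => //; exact: subset_trans CU UV.
Qed.

Lemma inner_content_clopen C : clopen C -> inner_content C = (m C)%:E.
Proof.
move=> cC; apply/eqP; rewrite eq_le inner_content_ge // andbT.
by apply: ge_ereal_sup => _ [D [cD DC] <-]; rewrite lee_fin content_le.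
Qed.

Lemma inner_content_le1 U : inner_content U <= 1.
Proof.
rewrite -[1]/(1%R%:E) -mT -inner_content_clopen; first exact: inner_content_le.
exact: clopenT.
Qed.

Lemma inner_content_bigsetU (U : (set G)^nat) n C : (forall i, open (U i)) ->
  clopen C -> C `<=` \bigcup_(i < n) U i ->
  (m C)%:E <= \sum_(0 <= i < n) inner_content (U i).
Proof.
move=> oU; elim: n C => [|n IHn] C cC CU.
  have -> : C = set0 by rewrite -subset0 => s /CU[].
  by rewrite content_set0 big_geq.
(* A clopen [E] cuts [C] into a part covered by the first n sets and a part inside [U n]. *)
have [|||E cE [CE EV]] := @clopen_between (C `\` U n) (\bigcup_(i < n) U i).
- by rewrite setDE; apply: closedI; [case: cC|apply: open_closedC].
- by apply: bigcup_open => i _; exact: oU.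
- move=> s [/CU[i /= + Us] nUs]; rewrite ltnS leq_eqVlt => /orP[/eqP iE|ltin].
    by exfalso; apply: nUs; rewrite -iE.
  by exists i.
rewrite (content_split cC cE) EFinD big_nat_recr //=; apply: leeD.
  by apply: IHn; [exact: clopenI|move=> s [_ /EV]].
apply: inner_content_ge; first exact: clopenD.
by move=> s [Cs nEs]; apply: contrapT => nUs; apply/nEs/CE.
Qed.

Lemma inner_content_bigcup (U : (set G)^nat) : (forall i, open (U i)) ->
  inner_content (\bigcup_i U i) <= \sum_(i <oo) inner_content (U i).
Proof.
move=> oU; apply: ge_ereal_sup => _ [C [cC CU] <-].
have : compact C by apply: subclosed_compact cG _ => //; case: cC.
rewrite compact_cover => /(_ nat setT U) [//|//|D' _ CD'].
apply: le_trans (@nneseries_lim_ge R (fun i => inner_content (U i)) xpredT 0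
  (\max_(i <- D') i).+1 _); last by move=> i _ _; exact: inner_content_ge0.
apply: inner_content_bigsetU => // s /CD'[i /= iD' Us]; exists i => //=.
by rewrite ltnS; exact: (@leq_bigmax_seq _ _ xpredT id).
Qed.

(* Approximation by open sets is needed because G may fail to be second
   countable: the clopen sets then do not generate the Borel sets. *)
Definition outer_content B : \bar R :=
  ereal_inf [set inner_content U | U in [set U | open U /\ B `<=` U]].

Lemma outer_content_le_inner B U : open U -> B `<=` U ->
  outer_content B <= inner_content U.
Proof. by move=> oU BU; apply: ereal_inf_lbound; exists U. Qed.

Lemma outer_content_open U : open U -> outer_content U = inner_content U.
Proof.
move=> oU; apply/eqP; rewrite eq_le outer_content_le_inner //=.
by apply: le_ereal_inf_tmp => _ [V [_ UV] <-]; exact: inner_content_le.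
Qed.

Lemma outer_content_clopen C : clopen C -> outer_content C = (m C)%:E.
Proof. by move=> cC; rewrite outer_content_open ?inner_content_clopen //; case: cC. Qed.

Lemma outer_content_ge0 B : 0 <= outer_content B.
Proof. by apply: le_ereal_inf_tmp => _ [U _ <-]; exact: inner_content_ge0. Qed.

Lemma outer_content_le1 B : outer_content B <= 1.
Proof.
apply: le_trans (inner_content_le1 setT); apply: outer_content_le_inner => //.
exact: openT.
Qed.

Lemma outer_content_fin B : outer_content B \is a fin_num.
Proof.
rewrite ge0_fin_numE ?outer_content_ge0 //.
by apply: le_lt_trans (outer_content_le1 B) _; rewrite ltry.
Qed.

Lemma outer_content0 : outer_content set0 = 0.
Proof. by rewrite outer_content_clopen ?content_set0 //; exact: clopen0. Qed.

Lemma outer_content_le : {homo outer_content : A B / A `<=` B >-> A <= B}.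
Proof.
move=> A B AB; apply: le_ereal_inf_tmp => _ [U [oU BU] <-].
by apply: outer_content_le_inner => //; exact: subset_trans AB BU.
Qed.

Lemma outer_content_sigma_subadditive : sigma_subadditive outer_content.
Proof.
move=> F; apply/lee_addgt0Pr => e e0.
have e2 n : (0 < e / (2 ^ n.+1)%:R)%R by rewrite divr_gt0 // ltr0n expn_gt0.
have cover n : exists U, [/\ open U, F n `<=` U &
    inner_content U <= outer_content (F n) + (e / (2 ^ n.+1)%:R)%:E].
  have [_ [U [oU FU] <-] lt] := lb_ereal_inf_adherent (e2 n) (outer_content_fin (F n)).
  by exists U; split=> //; exact: ltW.
have {cover}/choice[U UP] := cover.
apply: le_trans (epsilon_trick xpredT (fun n => outer_content_ge0 (F n)) (ltW e0)).
apply: (@le_trans _ _ (inner_content (\bigcup_n U n))).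
  apply: outer_content_le_inner; first by apply: bigcup_open => n _; have [] := UP n.
  by apply: subset_bigcup => n _; have [] := UP n.
apply: le_trans (inner_content_bigcup _) _; first by move=> n; have [] := UP n.
apply: lee_nneseries => n _; first by move=> _; exact: inner_content_ge0.
by have [] := UP n.
Qed.

Definition outer_content_outer_measure : outer_measure R G :=
  HB.pack outer_content (isOuterMeasure.Build R G outer_content outer_content0
    outer_content_ge0 outer_content_le outer_content_sigma_subadditive).

(** For an open [W] containing [X], exhaust the intersection of [W] and [V] by a clopen [C], then
    [W] minus [C] by a clopen [D]. As [C] and [D] are disjoint, their contents add up to at most the
    inner content of [W]. *)
Lemma open_caratheodory V : open V -> caratheodory_measurable outer_content V.
Proof.
move=> oV; apply: (@le_caratheodory_measurable R G outer_content_outer_measure) => X /=.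
apply: le_ereal_inf_tmp => _ [W [oW XW] <-].
rewrite -leeBrDr ?outer_content_fin //.
apply: (@le_trans _ _ (inner_content (W `&` V))).
  by apply: outer_content_le_inner; [exact: openI|exact: setSI].
apply: ge_ereal_sup => _ [C [cC CWV] <-].
rewrite leeBrDr ?outer_content_fin // addeC -leeBrDr //.
have oWC : open (W `\` C).
  by rewrite setDE; apply: openI => //; apply: closed_openC; case: cC.
apply: (@le_trans _ _ (inner_content (W `\` C))).
  apply: outer_content_le_inner => // s [/XW Ws nVs]; split=> // /CWV[_ Vs].
  exact: nVs.
apply: ge_ereal_sup => _ [D [cD DW] <-].
rewrite leeBrDr // -EFinD -mU //.
  by apply: inner_content_ge; [exact: clopenU|move=> s [/DW[]//|/CWV[]]].
by rewrite -subset0 => s [/DW[_ nCs]].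
Qed.

Definition haar_content : set (borel_type G) -> \bar R := outer_content.

Lemma borel_caratheodory (B : set (borel_type G)) :
  measurable B -> caratheodory_measurable outer_content B.
Proof.
apply: smallest_sub; last by move=> U; exact: open_caratheodory.
split.
- exact: (caratheodory_measurable_set0 outer_content_outer_measure).
- move=> A mA; rewrite setTD.
  exact: (@caratheodory_measurable_setC _ _ outer_content_outer_measure).
- exact: (@caratheodory_measurable_bigcup _ _ outer_content_outer_measure).
Qed.

Lemma haar_content_semi_sigma_additive : semi_sigma_additive haar_content.
Proof.
move=> F mF tF mUF.
apply: (@caratheodory_measure_sigma_additive R G outer_content_outer_measure) => //.
  by move=> i; apply: borel_caratheodory; exact: mF.
exact: borel_caratheodory.
Qed.

Lemma haar_contentT : haar_content setT = 1.
Proof. by rewrite /haar_content outer_content_clopen ?mT //; exact: clopenT. Qed.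

Let haar_measure : measure (borel_type G) R :=
  HB.pack haar_content (isMeasure.Build _ (borel_type G) R haar_content
    outer_content0 outer_content_ge0 haar_content_semi_sigma_additive).

Definition haar_probability : probability (borel_type G) R :=
  HB.pack (Measure.sort haar_measure)
    (Measure_isProbability.Build _ (borel_type G) R haar_measure haar_contentT).

End ContentExtension.

Section HaarMeasure.
Variables (G : preTopologicalGroupType) (R : realType) (m : set G -> R).
Implicit Types (B C D U V : set G).
Hypothesis cG : compact [set: G].
Hypothesis clopen_base : forall U (s : G), open U -> U s ->
  exists2 C, clopen C & C s /\ C `<=` U.
Hypothesis m_ge0 : forall C, clopen C -> (0 <= m C)%R.
Hypothesis mT : m setT = 1%R.
Hypothesis mU : forall C D, clopen C -> clopen D -> C `&` D = set0 ->
  m (C `|` D) = (m C + m D)%R.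
Hypothesis tG : topological_group G.
Hypothesis mM : forall (g : G) C, clopen C -> m [set (g * x)%g | x in C] = m C.
Local Open Scope ereal_scope.

Lemma translate_continuous (g : G) : continuous (fun x : G => (g * x)%g).
Proof.
move=> x; have [mulc _] := tG.
apply: (@continuous2_cvg _ _ _ _ _ _ _ _ (fun a b : G => (a * b)%g)).
- exact: mulc (g, x).
- exact: cvg_cst.
- exact: cvg_id.
Qed.

Lemma open_translate (g : G) U : open U -> open [set (g * x)%g | x in U].
Proof.
by move=> oU; rewrite left_translateE; apply: open_comp => // x _; exact: translate_continuous.
Qed.

Lemma clopen_translate (g : G) C : clopen C -> clopen [set (g * x)%g | x in C].
Proof.
move=> [oC cC]; split; first exact: open_translate.
by rewrite left_translateE; apply: closed_comp => // x _; exact: translate_continuous.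
Qed.

Lemma translateVK (g : G) B : [set (g^-1 * x)%g | x in [set (g * x)%g | x in B]] = B.
Proof.
apply/seteqP; split=> [_ [_ [x Bx <-] <-]|x Bx]; first by rewrite mulKg.
by exists (g * x)%g; [exists x|rewrite mulKg].
Qed.

Lemma inner_content_translate (g : G) U :
  inner_content m [set (g * x)%g | x in U] <= inner_content m U.
Proof.
apply: ge_ereal_sup => _ [C [cC CU] <-]; rewrite -(mM (g^-1)%g cC).
apply: inner_content_ge; first exact: clopen_translate.
by move=> _ [y /CU[x Ux <-] <-]; rewrite mulKg.
Qed.

Lemma outer_content_translate (g : G) B :
  outer_content m [set (g * x)%g | x in B] = outer_content m B.
Proof.
have le h D : outer_content m [set (h * x)%g | x in D] <= outer_content m D.
  apply: le_ereal_inf_tmp => _ [U [oU DU] <-].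
  apply: le_trans (inner_content_translate h U).
  by apply: outer_content_le_inner; [exact: open_translate|exact: image_subset].
by apply/eqP; rewrite eq_le le /=; rewrite -{1}(translateVK g B) le.
Qed.

(** Outer regularity is built into the outer content. Inner regularity on open sets holds because
    clopen subsets are compact. *)
Lemma haar_exists : exists nu : probability (borel_type G) R, normalized_haar nu.
Proof.
exists (haar_probability cG clopen_base m_ge0 mT mU); split.
- by move=> g B _; exact: outer_content_translate.
- move=> B _; congr ereal_inf; apply/seteqP; split=> _ [U [oU BU] <-].
    by exists U; [split|exact: outer_content_open].
  by exists U; [split|exact/esym/outer_content_open].
- move=> U oU; transitivity (inner_content m U); first exact: outer_content_open.
  apply/eqP; rewrite eq_le; apply/andP; split; apply: ge_ereal_sup.
    move=> _ [C [cC CU] <-]; rewrite -(outer_content_clopen m_ge0 mU cC).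
    apply: ereal_sup_ubound; exists C => //; split=> //.
    by apply: subclosed_compact cG _ => //; case: cC.
  by move=> _ [K [_ KU] <-]; rewrite -(outer_content_open m oU); exact: outer_content_le.
Qed.

End HaarMeasure.

(** * Clopen sets are definable, and the two cases of the theorem *)

Section ProfiniteDefinable.
Variables (L : language) (M : structure L) (A : set M).
Implicit Types X U : set (aut A).

Lemma definable_cylinder (l : seq {classic M}) (s : aut A) :
  definable [set t : aut A | forall m, m \in l -> t m = s m].
Proof.
elim: l => [|m l IHl].
  by have := @definableT L M A; congr definable; apply/seteqP; split.
have := definableI (definable_point A m (s m)) IHl; congr definable.
apply/seteqP; split=> t /=; first by move=> [tm tl] m'; rewrite in_cons => /orP[/eqP->|/tl].
by move=> tl; split=> [|m' m'l]; apply: tl; rewrite ?mem_head // in_cons m'l orbT.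
Qed.

Lemma definable_base U (s : aut A) : open U -> U s ->
  exists2 X, definable X & X s /\ X `<=` U.
Proof.
move=> oU Us; have [l lU] := nbhs_aut (open_nbhs_nbhs (conj oU Us)).
by exists [set t : aut A | forall m, m \in l -> t m = s m]; [exact: definable_cylinder|].
Qed.

Lemma clopen_definable X : compact [set: aut A] -> clopen X -> definable X.
Proof.
move=> cA [oX cX]; have : compact X by exact: subclosed_compact cX cA _.
rewrite compact_cover.
move=> /(_ {classic set (aut A)} [set E | definable E /\ E `<=` X] id) [|s Xs|D' D'E XD'].
- by move=> E [/definable_clopen[]].
- by have [E dE [Es EX]] := definable_base oX Xs; exists E.
have -> : X = \bigcup_(E in [set` D']) E.
  by apply/seteqP; split=> // s [E /= ED' Es]; have /set_mem[_] := D'E _ ED'; exact.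
rewrite bigcup_fset big_seq; elim/big_ind: _ => [|Y Z|E ED'].
- exact: definable_set0.
- exact: definableU.
- by have /set_mem[] := D'E _ ED'.
Qed.

End ProfiniteDefinable.

(** The limit of [X] is a majority of translates, hence definable, and has finitely many left
    translates; so it is left-invariant. *)
Lemma invariant_limit_mean (R : realType) (L : language) (T : theory L)
    (M : structure L) (A : set M) (X : set (aut A)) :
    atomic A -> strongly_homogeneous A -> eq_acl_closed T A ->
    definable X -> stable_set X ->
  left_mean X (0 : R)%R \/ left_mean X (1 : R)%R.
Proof.
move=> atom hom aclA dX Xst.
have [q qU qP] := generic_ultrafilter (aut A); have [l [tau lP]] := qP _ Xst.
have [k Xk] := Xst; have [gs DE] := limit_majority qU Xk.
have dD : definable (translate_limit q X) by rewrite DE; exact: definable_count.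
have fixedD := eq_acl_closed_fixed atom hom aclA dD lP.
(* Membership in an invariant limit is constant, so the list [[:: 1]] suffices, and its count is the
   membership value of the identity. *)
have := @left_mean_of_limit _ R q X [:: 1%g] (1%g \in translate_limit q X) qU Xst isT.
rewrite /= divr1; case: (1%g \in _) (fixedD ^~ 1%g) => D1 mean_c;
  [right|left]; apply: mean_c => s; by rewrite mul1g addn0 -[s]mulg1 D1.
Qed.

(** Uniqueness of the invariant Keisler measure then identifies every normalized Haar measure with
    [mean] on clopen sets. *)
Lemma haar_keisler (R : realType) (L : language) (M : structure L) (A : set M)
    (nu : probability (borel_type (aut A)) R) :
  normalized_haar nu -> invariant_keisler (fun X : set (aut A) => fine (nu X)).
Proof.
move=> nuH.
have mX X : definable X -> measurable (X : set (borel_type (aut A))).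
  by move=> /definable_clopen[oX _]; exact: sub_sigma_algebra.
split; first split.
- by move=> X _; exact: fine_ge0.
- by rewrite probability_setT.
- move=> X Y dX dY XY0; rewrite measureU; [|exact: mX|exact: mX|exact: XY0].
  by rewrite fineD //; apply: fin_num_measure; exact: mX.
- by move=> t X dX; rewrite (haar_invariant nuH) //; exact: mX.
Qed.

Unset Implicit Arguments.
Local Open Scope ring_scope.

Theorem theorem2p1 (R : realType) (L : language) (T : theory L)
    (M : structure L) (A : set M) :
  complete T -> models M T -> atomic A -> strongly_homogeneous A ->
  (stable T ->
     exists mu : set (aut A) -> R,
       unique_invariant_keisler mu /\
       (eq_acl_closed T A ->
          forall X, definable X -> mu X = 0 \/ mu X = 1)) /\
  (acl A = [set: M] ->
     exists mu : set (aut A) -> R,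
       [/\ unique_invariant_keisler mu,
           profinite (aut A),
           forall X : set (aut A), definable X <-> clopen X
         & (exists nu, @normalized_haar (aut A) R nu) /\
           forall nu, @normalized_haar (aut A) R nu ->
           forall X : set (aut A), clopen X -> (mu X)%:E = nu X]).
Proof.
move=> _ MT atom hom; split=> [Tst|aclM]; exists (@mean R L M A).
  have dst (X : set (aut A)) : definable X -> stable_set X by exact: (stable_definable MT Tst).
  split=> [|aclA X dX]; first exact: unique_invariant_keisler_mean.
  have [X0|X1] := invariant_limit_mean R atom hom aclA dX (dst X dX).
    by left; exact: mean_eq.
  by right; exact: mean_eq.
have dst (X : set (aut A)) : definable X -> stable_set X by exact: algebraic_definable.
have muP := unique_invariant_keisler_mean R dst.
have cA := aut_compact aclM.
have dcl (X : set (aut A)) : definable X <-> clopen X.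
  by split; [exact: definable_clopen|exact: clopen_definable].
split=> //; first exact: aut_profinite.
split=> [|nu nuH X /dcl dX].
  have [[[mu0 mu1 muU] muM] _] := muP.
  apply: (@haar_exists (aut A) R (@mean R L M A) cA) => //.
  - move=> U s oU Us; have [C dC CU] := definable_base oU Us.
    by exists C => //; apply/dcl.
  - by move=> C /dcl; exact: mu0.
  - by move=> C D /dcl dC /dcl dD; exact: muU.
  - exact: aut_topological_group.
  - by move=> g C /dcl; exact: muM.
have [_ /(_ _ (haar_keisler nuH) X dX) <-] := muP.
rewrite fineK //; apply: fin_num_measure; apply: sub_sigma_algebra.
by have /dcl[] := dX.
Qed.
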